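(* Let $\mathcal{P}$ be a fixed hyper-prior and $\delta>0$. Then with probability at least $1-\delta$ over the sampling of $S_1,\dots,S_n$, simultaneously for all hyper-posteriors $\mathcal{Q}$ and all posteriors $Q_1,\dots,Q_n$, $$\sum_{i=1}^n m_i\,\mathrm{kl}\big(\widehat{\mathcal{R}}_i(Q_i)\,\big|\,\mathcal{R}_i(Q_i)\big)\;\le\;\mathrm{KL}(\mathfrak{Q}\|\mathfrak{P})+\log\frac1\delta+\sum_{i=1}^n\log\big(2\sqrt{m_i}\big).$$
   Context: Multi-task setting: $n$ tasks; task $i$ has an unknown distribution $D_i$ on $\mathcal{Z}$, a loss $\ell_i:\mathcal{F}\times\mathcal{Z}\to[0,1]$, and a training set $S_i=(z_{i1},\dots,z_{im_i})$ of $m_i\ge1$ i.i.d. samples from $D_i$, the $S_i$ mutually independent. $\mathcal{M}(\mathcal{F})$ is the set of probability distributions on $\mathcal{F}$. For $Q\in\mathcal{M}(\mathcal{F})$: $\ell_i(Q,z)=\mathbb{E}_{f\sim Q}\ell_i(f,z)$, $\mathcal{R}_i(Q)=\mathbb{E}_{z\sim D_i}\ell_i(Q,z)$, $\widehat{\mathcal{R}}_i(Q)=\frac1{m_i}\sum_{j=1}^{m_i}\ell_i(Q,z_{ij})$. Hyper-prior $\mathcal{P}$ (data-independent) and hyper-posterior $\mathcal{Q}$ are distributions on $\mathcal{M}(\mathcal{F})$; posteriors $Q_i\in\mathcal{M}(\mathcal{F})$; $\mathcal{Q},Q_i$ may depend on the data. $\mathfrak{Q}=\mathcal{Q}\times Q_1\times\cdots\times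 Q_n$ on $\mathcal{M}(\mathcal{F})\times\mathcal{F}^n$; $\mathfrak{P}$ on the same space is generated by $P\sim\mathcal{P}$, then $f_1,\dots,f_n$ i.i.d. $\sim P$. $\mathrm{KL}$ is the Kullback–Leibler divergence, and $\mathrm{kl}(q|p)=q\log\frac qp+(1-q)\log\frac{1-q}{1-p}$ (convention $0\log0=0$). *)

(* Defs.v *)
From HB Require Import structures.
From mathcomp Require Import all_boot all_order all_algebra.
From mathcomp Require Import all_classical all_reals all_analysis.
Set Implicit Arguments. Unset Strict Implicit. Unset Printing Implicit Defensive.
Import Order.TTheory GRing.Theory Num.Theory.
Local Open Scope classical_set_scope.
Local Open Scope ring_scope.

Definition kl_term {R : realType} (a b : R) : \bar R :=
  if a == 0 then 0%E else if b == 0 then +oo%E else (a * ln (a / b))%:E.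

Definition kl {R : realType} (q p : R) : \bar R :=
  (kl_term q p + kl_term (1 - q) (1 - p))%E.

Definition is_density {d} {T : measurableType d} {R : realType}
  (mu nu : set T -> \bar R) (g : T -> R) : Prop :=
  measurable_fun setT g /\ (forall x, 0 <= g x) /\
  forall A, measurable A -> mu A = (\int[nu]_(x in A) (g x)%:E)%E.

(* Kullback-Leibler divergence KL(mu || nu) = E_nu[(dmu/dnu) log (dmu/dnu)]
   if mu << nu (i.e. a density exists), and +oo otherwise. *)
Definition KL {d} {T : measurableType d} {R : realType}
  (mu : set T -> \bar R) (nu : measure T R) : \bar R :=
  match pselect (exists g : T -> R, is_density mu nu g) with
  | left H => let g := projT1 (cid H) in
              (\int[nu]_x (g x * ln (g x))%:E)%E
  | right _ => +oo%E
  end.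

Definition gibbs_loss {d d'} {F : measurableType d} {Z : measurableType d'}
  {R : realType} (l : F -> Z -> R) (Q : probability F R) (z : Z) : R :=
  fine (\int[Q]_f (l f z)%:E)%E.

Definition true_risk {d d'} {F : measurableType d} {Z : measurableType d'}
  {R : realType} (D : probability Z R) (l : F -> Z -> R) (Q : probability F R) : R :=
  fine (\int[D]_z (gibbs_loss l Q z)%:E)%E.

Definition emp_risk {d d'} {F : measurableType d} {Z : measurableType d'}
  {R : realType} (m : nat) (s : nat -> Z) (l : F -> Z -> R) (Q : probability F R) : R :=
  (m%:R)^-1 * \sum_(j < m) gibbs_loss l Q (s j).

Definition cyl {T : Type} (n : nat) (B : 'I_n -> set T) : set (n.-tuple T) :=
  [set t | forall i : 'I_n, B i (tnth t i)].

(* The law frakP on M(F) x F^n: P ~ hyperprior, then f_1..f_n iid ~ P,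
   characterized on measurable rectangles (which form a generating pi-system). *)
Definition is_hyper_joint {d} {F : measurableType d} {R : realType} (n : nat)
  (hP : probability (pprobability F R) R)
  (frakP : probability (pprobability F R * n.-tuple F)%type R) : Prop :=
  forall (A : set (pprobability F R)) (B : 'I_n -> set F),
    measurable A -> (forall i, measurable (B i)) ->
    frakP (A `*` cyl B) =
      (\int[hP]_(P in A) (\prod_(i < n) fine (P (B i)))%:E)%E.

Definition is_product_law {d} {F : measurableType d} {R : realType} (n : nat)
  (hQ : probability (pprobability F R) R) (Q : 'I_n -> probability F R)
  (frakQ : probability (pprobability F R * n.-tuple F)%type R) : Prop :=
  forall (A : set (pprobability F R)) (B : 'I_n -> set F),
    measurable A -> (forall i, measurable (B i)) ->
    frakQ (A `*` cyl B) = (fine (hQ A) * \prod_(i < n) fine (Q i (B i)))%:E.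

Definition iid_samples {d0 d'} {Omega : measurableType d0} {Z : measurableType d'}
  {R : realType} (Pr : probability Omega R) (n : nat) (m : 'I_n -> nat)
  (D : 'I_n -> probability Z R) (z : 'I_n -> nat -> Omega -> Z) : Prop :=
  (forall i j, measurable_fun setT (z i j)) /\
  (forall i j, (j < m i)%N -> forall A, measurable A -> Pr (z i j @^-1` A) = D i A) /\
  (forall B : 'I_n -> nat -> set Z, (forall i j, measurable (B i j)) ->
     Pr [set w | forall i : 'I_n, forall j, (j < m i)%N -> B i j (z i j w)] =
     (\prod_(i < n) \prod_(j < m i) fine (Pr (z i (nat_of_ord j) @^-1` B i j)))%:E).

(* Main.v *)
Require Import Defs.
From HB Require Import structures.
From mathcomp Require Import all_boot all_order all_algebra.
From mathcomp Require Import all_classical all_reals all_analysis.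
From mathcomp Require Import measurable_realfun.
From mathcomp Require Import ring lra.
Set Implicit Arguments. Unset Strict Implicit. Unset Printing Implicit Defensive.
Import Order.TTheory GRing.Theory Num.Theory.
Local Open Scope classical_set_scope.
Local Open Scope ring_scope.

(* [kl (q | p)] is the supremum over [u, v > 0] of
     [q ln u + (1 - q) ln v + 1 - (p u + (1 - p) v)],
   which is affine in [(q, p)] and bounded.  Hence the left-hand side of the bound
   is a supremum of [frakQ]-expectations of bounded functions of [f_1, .., f_n], and
   the Donsker-Varadhan inequality reduces the theorem to controlling one
   exponential moment under the fixed law [frakP], uniformly in [u] and [v].

   For one task with losses [x_j] and risk [p], weighted AM-GM gives, with
   [r = p u / (p u + (1 - p) v)],
     [exp (sum_j affine (x_j, p)) <= prod_j (x_j / p * r + (1 - x_j) / (1 - p) * (1 - r))].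
   Expanding the product over subsets [A] of the sample and maximising
   [r ^ #|A| * (1 - r) ^ (m - #|A|)] over [r] yields a bound free of [u] and [v].  By
   independence its expectation is at most
     [sum_k C(m, k) (k / m) ^ k (1 - k / m) ^ (m - k)],
   which by an identity of Abel equals [S = sum_j a_j] with [a_j = m ^_ j / m ^ j].
   Since [0 <= a_j <= 1] and [sum_j j a_j = m], one has [S (S - 1) / 2 <= m], so
   [S <= 2 sqrt m].  Tonelli and Markov then produce the event. *)

(** * The binomial sum *)

Section finite_differences.
Variable R : comNzRingType.

(** The n-th forward difference with step 1, in closed form. *)
Definition fdiff (n : nat) (f : R -> R) (x : R) : R :=
  \sum_(k < n.+1) (-1) ^+ (n - k) * f (x + k%:R) *+ 'C(n, k).

Lemma fdiffS n f x : fdiff n.+1 f x = fdiff n f (x + 1) - fdiff n f x.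
Proof.
rewrite /fdiff big_ord_recl [in X in _ - X]big_ord_recl /= !bin0 !subn0 addr0.
rewrite (eq_bigr (fun k : 'I_n.+1 =>
  (-1) ^+ (n - k) * f (x + 1 + k%:R) *+ 'C(n, k) +
  (-1) ^+ (n - k) * f (x + 1 + k%:R) *+ 'C(n, k.+1))); last first.
  by move=> k _; rewrite /bump /= add1n subSS binS mulrnDr addrC -nat1r addrA.
rewrite big_split /= addrCA; congr (_ + _).
rewrite [X in _ + X]big_ord_recr /= bin_small// addr0 opprD exprS mulN1r mulNr !mulr1n.
congr (_ + _); rewrite -sumrN; apply: eq_bigr => k _.
rewrite /bump /= add1n -(subnSK (ltn_ord k)) exprS mulN1r -mulNrn mulNr.
by rewrite -nat1r addrA.
Qed.

(** Each difference lowers the degree by one and multiplies the leading coefficient by the degree,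
    so only [t ^ n] survives n differences, as [n!]. *)
Lemma fdiff_exp n j x : (j <= n)%N ->
  fdiff n (fun t => t ^+ j) x = (n`! * (j == n))%:R.
Proof.
elim: n j x => [|n IH] j x; first by rewrite leqn0 => /eqP ->; rewrite /fdiff big_ord1 expr0 !mul1r.
move=> jn; rewrite fdiffS.
(* Binomial expansion of [(t + 1) ^ j]; the top term cancels against [fdiff n] at [x], which leaves
   powers below [j]. *)
have -> : fdiff n (fun t => t ^+ j) (x + 1) =
    \sum_(i < j.+1) fdiff n (fun t => t ^+ i) x *+ 'C(j, i).
  rewrite /fdiff; under [RHS]eq_bigr do rewrite -sumrMnl.
  rewrite exchange_big /=; apply: eq_bigr => k _.
  rewrite addrAC addrC exprDn mulr_sumr -sumrMnl.
  by apply: eq_bigr => i _; rewrite expr1n mul1r mulrnAr mulrnAC.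
rewrite big_ord_recr /= binn mulr1n addrK.
case: j jn => [|j] jn; first by rewrite big_ord0 muln0.
rewrite big_ord_recr /= big1 ?add0r; last first.
  move=> i _; rewrite IH; last by rewrite (leq_trans (ltnW (ltn_ord i)))// -ltnS.
  by rewrite ltn_eqF ?muln0 ?mul0rn// (leq_trans (ltn_ord i)).
rewrite IH // eqSS; case: eqP => [->|_]; last by rewrite !muln0 mul0rn.
by rewrite !muln1 binSn factS mulnC natrM mulr_natr.
Qed.

End finite_differences.

(** * An identity of Abel and Hurwitz *)

Section abel.
Variable R : numFieldType.

Lemma deriv_inj_at (p q : {poly R}) a : p^`() = q^`() -> p.[a] = q.[a] -> p = q.
Proof.
move=> dpq pqa; apply/eqP; rewrite -subr_eq0; apply/eqP.
have cst : p - q = ((p - q)`_0)%:P.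
  apply/polyP => -[|i]; rewrite coefC //=.
  have := congr1 (fun r : {poly R} => r`_i) dpq; rewrite !coef_deriv => /eqP.
  by rewrite -subr_eq0 -mulrnBl mulrn_eq0 /= coefB => /eqP.
have : (p - q).[a] = 0 by rewrite hornerD hornerN pqa subrr.
by rewrite cst hornerC => ->.
Qed.

(** The two sides are polynomials in the second variable [y], with [x] fixed, so that they can be
    differentiated in [y]. *)
Let abel_l n (x : R) : {poly R} :=
  \sum_(k < n.+1) ((x + k%:R) ^+ k)%:P * ('X + (n - k)%:R%:P) ^+ (n - k) *+ 'C(n, k).
Let abel_r n (x : R) : {poly R} :=
  \sum_(j < n.+1) ('X + (x + n%:R)%:P) ^+ (n - j) *+ n ^_ j.

Let deriv_shift (c : R) n : (('X + c%:P) ^+ n.+1)^`() = ('X + c%:P) ^+ n *+ n.+1.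
Proof. by rewrite deriv_exp derivD derivX derivC addr0 mul1r. Qed.

(* Both sides have the same derivative by induction; at [y = - x - n] the left
   side is an n-th finite difference of [t ^ n]. *)
Lemma abel_hurwitz_poly n (x : R) : abel_l n x = abel_r n x.
Proof.
elim: n => [|n IH]; first by rewrite /abel_l /abel_r !big_ord1 !expr0 mulr1 ffactn0.
apply: (@deriv_inj_at _ _ (- (x + n.+1%:R))).
(* Differentiation in [y] lowers [n] by one, shifts [y] by 1 and brings out a factor [n + 1], on
   both sides alike. *)
- have -> : (abel_l n.+1 x)^`() = (abel_l n x \Po ('X + 1%:P)) *+ n.+1.
    rewrite /abel_l raddf_sum big_ord_recr /= subnn expr0 mulr1 binn derivMn derivC mul0rn addr0.
    rewrite (raddf_sum (comp_poly _)) -sumrMnl; apply: eq_bigr => k _.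
    have kn : (k <= n)%N by rewrite -ltnS.
    rewrite subSn // derivMn derivM derivC mul0r add0r deriv_shift /=.
    rewrite (raddfMn (comp_poly _)) /= comp_polyM comp_polyC (rmorphXn (comp_poly _)) /=.
    rewrite comp_polyD comp_polyX comp_polyC -addrA -polyCD nat1r mulrnAr -!mulrnA; congr (_ *+ _).
    by rewrite -subSn// [RHS]mulnC (mul_bin_down n.+1).
  have -> : (abel_r n.+1 x)^`() = (abel_r n x \Po ('X + 1%:P)) *+ n.+1.
    rewrite /abel_r raddf_sum big_ord_recr /= subnn expr0 derivMn derivC mul0rn addr0.
    rewrite (raddf_sum (comp_poly _)) -sumrMnl; apply: eq_bigr => k _.
    have kn : (k <= n)%N by rewrite -ltnS.
    rewrite subSn // derivMn deriv_shift /=.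
    rewrite (raddfMn (comp_poly _)) /= (rmorphXn (comp_poly _)) /= comp_polyD comp_polyX comp_polyC.
    rewrite -addrA -polyCD (addrC 1) -addrA natr1 -!mulrnA; congr (_ *+ _).
    by rewrite -subSn// mulnC -ffactnSr ffactSS mulnC.
  by rewrite IH.
- rewrite /abel_l /abel_r !horner_sum [RHS]big_ord_recr /= subnn expr0.
  (* At this [y] the base [y + x + n + 1] is 0, so only the last term of the right side remains,
     namely [(n + 1)!]. *)
  rewrite [X in _ = X + _]big1 ?add0r; last first.
    move=> j _; rewrite hornerMn horner_exp hornerD hornerX hornerC addNr.
    by rewrite expr0n subn_eq0 leqNgt ltn_ord mul0rn.
  rewrite ffactnn hornerMn hornerC.
  have /esym := fdiff_exp x (leqnn n.+1); rewrite eqxx muln1 => ->.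
  apply: eq_bigr => k _; rewrite hornerMn hornerM hornerC horner_exp hornerD hornerX hornerC.
  have kn : (k <= n.+1)%N by rewrite -ltnS.
  congr (_ *+ _).
  (* Both bases are now [x + k] up to sign, and the exponents add up to [n + 1]. *)
  have -> : - (x + n.+1%:R) + (n.+1 - k)%:R = - (x + k%:R) :> R by rewrite natrB //; ring.
  by rewrite [in LHS]exprNn mulrCA -exprD subnKC.
Qed.

Lemma abel_hurwitz n : \sum_(k < n.+1) (k%:R ^+ k * (n - k)%:R ^+ (n - k)) *+ 'C(n, k) =
  \sum_(j < n.+1) n%:R ^+ (n - j) *+ n ^_ j :> R.
Proof.
have := congr1 (horner ^~ 0) (abel_hurwitz_poly n 0); rewrite /abel_l /abel_r !horner_sum.
under eq_bigr do rewrite hornerMn hornerM hornerC horner_exp hornerD hornerX hornerC !add0r.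
by under [RHS]eq_bigr do rewrite hornerMn horner_exp hornerD hornerX hornerC !add0r.
Qed.

End abel.

(** * Bounding the binomial sum *)

Section binomial_moment.
Variable R : realType.

(* Likelihood of a given sequence with [k] successes out of [m], maximised over the
   success probability. *)
Definition maxlik (m k : nat) : R :=
  (k%:R / m%:R) ^+ k * ((m - k)%:R / m%:R) ^+ (m - k).

(* For given [S], the right-hand sum is smallest when the first weights are full. *)
Lemma sum_unit_weights (a : nat -> R) n : (forall j, 0 <= a j <= 1) ->
  let S := \sum_(j < n) a j in
  S <= n%:R /\ S * (S - 1) / 2 <= \sum_(j < n) j%:R * a j.
Proof.
move=> a01; elim: n => [|n [IH1 IH2]] /=; first by rewrite !big_ord0 lexx !mul0r.
rewrite !big_ord_recr /=; set S := \sum_(_ < _) _ in IH1 IH2 *.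
have /andP[a0 a1] := a01 n; rewrite -natr1; split; first by lra.
(* Adding a weight [a] raises [S (S - 1) / 2] by [a S + a (a - 1) / 2], which is at most [a S],
   hence at most [n a]. *)
by nra.
Qed.

Lemma sum_maxlik_le m : (0 < m)%N ->
  \sum_(k < m.+1) maxlik m k *+ 'C(m, k) <= 2 * Num.sqrt m%:R.
Proof.
move=> m0; have mr0 : 0 < m%:R :> R by rewrite ltr0n.
have mrN0 : m%:R != 0 :> R by rewrite gt_eqF.
(* The probability that [j] uniform draws from [m] items are distinct. *)
pose a j : R := (m ^_ j)%:R / m%:R ^+ j.
have -> : \sum_(k < m.+1) maxlik m k *+ 'C(m, k) = \sum_(j < m.+1) a j.
  transitivity ((m%:R ^+ m)^-1 * \sum_(j < m.+1) m%:R ^+ (m - j) *+ m ^_ j : R).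
    rewrite -abel_hurwitz mulr_sumr; apply: eq_bigr => k _.
    have km : (k <= m)%N by rewrite -ltnS.
    rewrite /maxlik !expr_div_n mulrACA -invfM -exprD subnKC //.
    by rewrite mulrC mulrnAr.
  rewrite mulr_sumr; apply: eq_bigr => j _.
  have jm : (j <= m)%N by rewrite -ltnS.
  rewrite /a -[_ *+ m ^_ j]mulr_natr.
  have -> : m%:R ^+ m = m%:R ^+ (m - j) * m%:R ^+ j :> R by rewrite -exprD subnK.
  by field; rewrite !expf_neq0.
have a01 j : 0 <= a j <= 1.
  rewrite /a divr_ge0 ?exprn_ge0 ?ler0n//= ler_pdivrMr ?exprn_gt0// mul1r -natrX ler_nat.
  elim: j => [|j IH]; first by rewrite ffactn0.
  by rewrite ffactnSr expnSr leq_mul // leq_subr.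
have [_] := @sum_unit_weights a m.+1 a01.
have -> : \sum_(j < m.+1) j%:R * a j = m%:R.
  (* Since [a (j + 1) = a j * (1 - j / m)], the sum telescopes; it ends at [a (m + 1) = 0]. *)
  have tele j : (j <= m)%N -> j%:R * a j = m%:R * (a j - a j.+1).
    move=> jm; rewrite /a ffactnSr natrM natrB // exprS; field.
    by rewrite expf_neq0.
  rewrite (eq_bigr (fun j : 'I_m.+1 => m%:R * (a j - a j.+1))); last first.
    by move=> j _; rewrite tele // -ltnS.
  rewrite -mulr_sumr -(big_mkord xpredT (fun j => a j - a j.+1)).
  rewrite (eq_bigr (fun j => - (a j.+1 - a j))); last by move=> j _; rewrite opprB.
  by rewrite sumrN telescope_sumr // /a ffact_small // ffactn0 expr0 mul0r sub0r opprK divr1 mulr1.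
set S := \sum_(_ < _) _.
have s1 : 1 <= Num.sqrt m%:R :> R by rewrite -[X in X <= _]sqrtr1 ler_sqrt // ler1n.
have := sqr_sqrtr (ltW mr0); set s := Num.sqrt _ in s1 * => <- hS.
(* If [S > 2 s] with [s >= 1], then [S (S - 1) / 2 > s (2 s - 1) >= s ^ 2], against [hS]. *)
rewrite leNgt; apply/negP => sS; nra.
Qed.

End binomial_moment.

(** * Likelihood ratios and tangents of kl *)

Section likelihood_ratio.
Variable R : realType.
Implicit Types (p q r u v x : R) (m k : nat).

Lemma ln_le_sub1 x : 0 < x -> ln x <= x - 1.
Proof. by move=> x0; have := @le_ln1Dx R (x - 1); rewrite [1 + _]addrC subrK; apply; lra. Qed.

(** For [k > 0] this is [t <= exp (t - 1)] at [t = m r / k], raised to the power [k]. The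
    exponentials obtained for [(k, r)] and [(m - k, 1 - r)] cancel in [le_maxlik]. *)
Lemma expr_le_maxlik m k r : (0 < m)%N -> 0 <= r ->
  r ^+ k <= (k%:R / m%:R) ^+ k * expR (m%:R * r - k%:R).
Proof.
move=> m0 r0.
case: k => [|k]; first by rewrite !expr0 mul1r subr0 -[X in X <= _]expR0 ler_expR mulr_ge0.
have mr0 : 0 < m%:R :> R by rewrite ltr0n.
have kr0 : 0 < k.+1%:R :> R by rewrite ltr0n.
have -> : m%:R * r - k.+1%:R = k.+1%:R * (m%:R * r / k.+1%:R - 1) :> R.
  by field; rewrite gt_eqF.
rewrite expRM_natl -exprMn lerXn2r ?nnegrE ?mulr_ge0 ?expR_ge0 ?invr_ge0 //.
have := expR_ge1Dx (m%:R * r / k.+1%:R - 1 : R).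
rewrite [1 + _]addrC subrK => /(ler_wpM2l (ltW (divr_gt0 kr0 mr0))).
suff -> : k.+1%:R / m%:R * (m%:R * r / k.+1%:R) = r by [].
by field; rewrite !gt_eqF.
Qed.

Lemma le_maxlik m k r : (0 < m)%N -> (k <= m)%N -> 0 <= r <= 1 ->
  r ^+ k * (1 - r) ^+ (m - k) <= maxlik R m k.
Proof.
move=> m0 km /andP[r0 r1].
have h1 := expr_le_maxlik k m0 r0.
have r1' : 0 <= 1 - r by rewrite subr_ge0.
have h2 := expr_le_maxlik (m - k) m0 r1'.
apply: (le_trans (ler_pM _ _ h1 h2)); rewrite ?exprn_ge0 //.
rewrite mulrACA -expRD natrB //.
have -> : m%:R * r - k%:R + (m%:R * (1 - r) - (m%:R - k%:R)) = 0 :> R by ring.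
by rewrite expR0 mulr1 /maxlik natrB.
Qed.

(** Density of the Bernoulli law of mean [x] against that of mean [p], at the outcome [b]. *)
Definition lratio (p x : R) (b : bool) : R := if b then x / p else (1 - x) / (1 - p).

(* Bernoulli rounding of the [x j]: the maximised likelihood ratio against [p] averaged
   over independent roundings.  Factors with [p = 0] or [p = 1] are junk ([y / 0 = 0]),
   harmless when the corresponding numerator vanishes. *)
Definition mixed_ratio m (p : R) (x : 'I_m -> R) : R :=
  \sum_(A : {set 'I_m}) maxlik R m #|A| * \prod_j lratio p (x j) (j \in A).

Lemma maxlik_ge0 m k : 0 <= maxlik R m k.
Proof. by rewrite mulr_ge0 ?exprn_ge0 ?divr_ge0. Qed.

Lemma lratio_ge0 p x b : 0 <= p <= 1 -> 0 <= x <= 1 -> 0 <= lratio p x b.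
Proof.
move=> /andP[p0 p1] /andP[x0 x1]; rewrite /lratio; case: b; rewrite divr_ge0 //; lra.
Qed.

(* Affine in [(q, p)], so that averaging it replaces Jensen's inequality for [kl];
   it touches [kl] where [q = p u] and [1 - q = (1 - p) v]. *)
Definition kl_tangent (u v q p : R) : R :=
  q * ln u + (1 - q) * ln v + 1 - (p * u + (1 - p) * v).

(** The logarithm lies below its tangent at the mean [g]; the linear terms of the tangents at [u]
    and [v] average to 0. *)
Lemma weighted_amgm u v x : 0 < u -> 0 < v -> 0 <= x <= 1 ->
  expR (x * ln u + (1 - x) * ln v) <= x * u + (1 - x) * v.
Proof.
move=> u0 v0 /andP[x0 x1].
have : 0 < x * u + (1 - x) * v by nra.
move gE : (x * u + _) => g g0.
rewrite -[X in _ <= X]lnK ?posrE // ler_expR.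
have hu : ln u - ln g <= u / g - 1 by rewrite -ln_div ?posrE // ln_le_sub1 ?divr_gt0.
have hv : ln v - ln g <= v / g - 1 by rewrite -ln_div ?posrE // ln_le_sub1 ?divr_gt0.
have : x * (u / g - 1) + (1 - x) * (v / g - 1) = 0.
  transitivity ((x * u + (1 - x) * v) / g - 1); first by ring.
  by rewrite gE divff ?subrr // gt_eqF.
nra.
Qed.

(** The exponent is [x ln u + (1 - x) ln v], handled by AM-GM, plus [1 - s], handled by
    [exp (1 - s) <= 1 / s]. The conditions at [p = 0] and [p = 1] make the numerator vanish wherever
    [p] or [1 - p] cannot be cancelled. *)
Lemma expR_tangent_le u v p x : 0 < u -> 0 < v -> 0 <= p <= 1 -> 0 <= x <= 1 ->
  (p = 0 -> x = 0) -> (p = 1 -> x = 1) ->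
  let r := p * u / (p * u + (1 - p) * v) in
  expR (kl_tangent u v x p) <= lratio p x true * r + lratio p x false * (1 - r).
Proof.
move=> u0 v0 /[dup] hp /andP[p0 p1] hx xp0 xp1 /=; set s := p * u + _.
have s0 : 0 < s by rewrite /s; nra.
have sN0 : s != 0 by rewrite gt_eqF.
have -> : lratio p x true * (p * u / s) + lratio p x false * (1 - p * u / s) =
    (x * u + (1 - x) * v) / s.
  have -> : 1 - p * u / s = (1 - p) * v / s.
    by apply: (mulIf sN0); rewrite mulrBl !divfK // mul1r /s; ring.
  rewrite /lratio [RHS]mulrDl; congr (_ + _).
    have [p0E|pN0] := eqVneq p 0; last by field; rewrite sN0.
    by rewrite (xp0 p0E) !mul0r.
  have [p1E|pN1] := eqVneq p 1.
    by rewrite xp1 // p1E subrr !mul0r.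
  by field; rewrite sN0 subr_eq0 eq_sym.
have -> : kl_tangent u v x p = (x * ln u + (1 - x) * ln v) + (1 - s).
  by rewrite /kl_tangent -/s; ring.
rewrite expRD ler_pM ?expR_ge0 ?weighted_amgm //.
rewrite -[s^-1]lnK ?posrE ?invr_gt0 // ler_expR lnV ?posrE //.
by have := ln_le_sub1 s0; lra.
Qed.

(** Once the product is expanded over subsets, [u] and [v] occur only through the powers of [r] and
    [1 - r], which [le_maxlik] removes. *)
Lemma expR_sum_tangent_le m u v p (x : 'I_m -> R) : (0 < m)%N ->
  0 < u -> 0 < v -> 0 <= p <= 1 -> (forall j, 0 <= x j <= 1) ->
  (p = 0 -> forall j, x j = 0) -> (p = 1 -> forall j, x j = 1) ->
  expR (\sum_j kl_tangent u v (x j) p) <= mixed_ratio p x.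
Proof.
move=> m0 u0 v0 hp hx xp0 xp1; rewrite expR_sum.
set r := p * u / (p * u + (1 - p) * v).
have hr : 0 <= r <= 1.
  have /andP[p0 p1] := hp.
  have s0 : 0 < p * u + (1 - p) * v by nra.
  have pu0 : 0 <= p * u by rewrite mulr_ge0 // ltW.
  have pv0 : 0 <= (1 - p) * v by rewrite mulr_ge0 ?subr_ge0 // ltW.
  by rewrite /r divr_ge0 ?(ltW s0)//= ler_pdivrMr // mul1r lerDl.
apply: (@le_trans _ _ (\prod_j (lratio p (x j) true * r + lratio p (x j) false * (1 - r)))).
  apply: ler_prod => j _; rewrite expR_ge0 /=.
  by apply: expR_tangent_le => // [/xp0|/xp1] ->.
rewrite bigA_distr; apply: ler_sum => A _.
rewrite (eq_bigr (fun j => (if j \in A then r else 1 - r) * lratio p (x j) (j \in A))); last first.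
  by move=> j _; case: ifP => _; rewrite mulrC.
rewrite big_split /=; apply: ler_wpM2r.
  by apply: prodr_ge0 => j _; rewrite lratio_ge0.
rewrite (bigID (mem A)) /=.
rewrite (eq_bigr (fun=> r)); last by move=> j ->.
rewrite [X in _ * X](eq_bigr (fun=> 1 - r)); last by move=> j /negbTE ->.
rewrite !prodr_const.
have -> : #|[predC A]| = (m - #|A|)%N by rewrite -[X in (X - _)%N]card_ord -(cardC (mem A)) addKn.
by apply: le_maxlik => //; rewrite -[leqRHS]card_ord max_card.
Qed.

Lemma sum_mixed_weights m : 
  \sum_(A : {set 'I_m}) maxlik R m #|A| = \sum_(k < m.+1) maxlik R m k *+ 'C(m, k).
Proof.
rewrite (partition_big (fun A : {set 'I_m} => inord #|A| : 'I_m.+1) xpredT) //=.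
have cA (A : {set 'I_m}) : (#|A| < m.+1)%N by rewrite ltnS -[leqRHS]card_ord max_card.
apply: eq_bigr => k _.
rewrite (eq_bigl (fun A => A \in [set B : {set 'I_m} | #|B| == k]%SET)); last first.
  by move=> A; rewrite inE -val_eqE /= inordK.
rewrite (eq_bigr (fun=> maxlik R m k)) ?sumr_const ?card_draws ?card_ord//.
by move=> A; rewrite inE => /eqP ->.
Qed.

End likelihood_ratio.

(** * Variational formula for kl *)

Section kl_variational.
Variable R : realType.
Implicit Types (a b q p : R).
Local Open Scope ereal_scope.

Lemma kl_term_gtNy a b : kl_term a b != -oo.
Proof. by rewrite /kl_term; case: ifP => // _; case: ifP. Qed.

(** [kl_term a b] is the supremum over [u > 0] of [a ln u + a - b u], attained at [u = a / b] when
    both are positive. *)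
Lemma lt_kl_term a b (M : R) : (0 <= a)%R -> (0 <= b)%R -> M%:E < kl_term a b ->
  exists2 u : R, (0 < u)%R & (M <= a * ln u + a - b * u)%R.
Proof.
move=> a0 b0; rewrite /kl_term; case: eqVneq => [->|aN0].
  (* Here [b u <= - M] is required; dividing by [b + 1] also covers [b = 0]. *)
  rewrite lte_fin => M0; exists (- M / (b + 1))%R; first by rewrite divr_gt0; lra.
  rewrite mul0r !add0r lerNr mulrA ler_pdivrMr; last lra.
  by nra.
have {}a0 : (0 < a)%R by rewrite lt_neqAle eq_sym aN0.
case: eqVneq => [->|bN0].
  (* With [b = 0] the supremum is infinite; this [u] solves [a ln u + a = M]. *)
  move=> _; exists (expR ((M - a) / a)); first exact: expR_gt0.
  by rewrite expRK mul0r subr0 mulrC divfK // subrK.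
have {}b0 : (0 < b)%R by rewrite lt_neqAle eq_sym bN0.
rewrite lte_fin => /ltW h; exists (a / b)%R; first exact: divr_gt0.
by rewrite [(b * _)%R]mulrC divfK // addrK.
Qed.

Lemma lt_adde_split (x y : \bar R) (M : R) : x != -oo -> y != -oo -> M%:E < x + y ->
  exists b c : R, [/\ b%:E < x, c%:E < y & (M < b + c)%R].
Proof.
case: x => [x| |] // ; case: y => [y| |] // _ _.
(* Each term gives up a third of the gap, so a third remains. *)
- rewrite -EFinD lte_fin => h; exists (x - (x + y - M) / 3)%R, (y - (x + y - M) / 3)%R.
  by rewrite !lte_fin; split; lra.
- move=> _; exists (x - 1)%R, (M - x + 2)%R; rewrite ltry lte_fin; split=> //; lra.
- move=> _; exists (M - y + 2)%R, (y - 1)%R; rewrite ltry lte_fin; split=> //; lra.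
- by move=> _; exists 0%R, (M + 1)%R; rewrite !ltry; split=> //; lra.
Qed.

Lemma lt_sume_split n (a : 'I_n -> \bar R) (M : R) : (forall i, a i != -oo) ->
  M%:E < \sum_i a i ->
  exists2 b : 'I_n -> R, forall i, (b i)%:E < a i & (M < \sum_i b i)%R.
Proof.
elim: n a M => [|n IH] a M aNy.
  by rewrite big_ord0 lte_fin => M0; exists (fun=> 0%R) => [[]//|]; rewrite big_ord0.
rewrite big_ord_recl => /lt_adde_split[//||b [c [ba /IH[//|d da cd] Mbc]]].
  elim/big_ind : _ => [//|x y x0 y0|i _]; last exact: aNy.
  by rewrite adde_eq_ninfty negb_or x0.
exists (fun i => if unlift ord0 i is Some j then d j else b).
  by move=> i; case: unliftP => [j ->|->].
rewrite big_ord_recl unlift_none; under eq_bigr do rewrite liftK.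
by lra.
Qed.

(** The two terms are treated separately; their constants [q] and [1 - q] add up to the 1 in
    [kl_tangent]. *)
Lemma lt_kl q p (m : nat) (M : R) : (0 < m)%N -> (0 <= q <= 1)%R -> (0 <= p <= 1)%R ->
  M%:E < m%:R%:E * kl q p ->
  exists u v : R, [/\ (0 < u)%R, (0 < v)%R & (M <= m%:R * kl_tangent u v q p)%R].
Proof.
move=> m0 /andP[q0 q1] /andP[p0 p1] h.
have mr0 : (0 < m%:R :> R)%R by rewrite ltr0n.
have : (M / m%:R)%:E < kl q p.
  by rewrite EFinM muleC lte_pdivrMl.
move=> /lt_adde_split[||b [c [hb hc bc]]]; rewrite ?kl_term_gtNy//.
have [u u0 hu] := lt_kl_term q0 p0 hb.
have [v v0 hv] : exists2 v, (0 < v)%R & (c <= (1 - q) * ln v + (1 - q) - (1 - p) * v)%R.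
  by apply: lt_kl_term hc; lra.
exists u, v; split => //; rewrite mulrC -ler_pdivrMr // /kl_tangent; lra.
Qed.

Lemma kl_gtNy q p (m : nat) : (m%:R)%:E * kl q p != -oo :> \bar R.
Proof.
have [->|m0] := posnP m; first by rewrite mul0e.
have : kl q p != -oo by rewrite /kl adde_eq_ninfty negb_or !kl_term_gtNy.
by case: (kl q p) => [r| |] //= _; rewrite mulry gtr0_sg ?ltr0n// mul1e.
Qed.

End kl_variational.

(** * Bounded expectations, independence and change of measure *)

Section weighted_pushforward.
Local Open Scope ereal_scope.
Context d1 d2 (X : measurableType d1) (Y : measurableType d2) (R : realType).
Variables (nu : {measure set X -> \bar R}) (mu : {measure set Y -> \bar R}).
Variables (phi : X -> Y) (g : X -> R).
Hypotheses (mphi : measurable_fun setT phi) (mg : measurable_fun setT g).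
Hypothesis g0 : forall x, (0 <= g x)%R.
Hypothesis muE : forall A, measurable A -> mu A = \int[nu]_x (\1_A (phi x) * g x)%:E.

Import HBNNSimple.

Let nnsfun_weighted_pushforward (h : {nnsfun Y >-> R}) :
  \int[mu]_y (h y)%:E = \int[nu]_x (h (phi x) * g x)%:E.
Proof.
transitivity (\int[mu]_y (\sum_(r \in range h) (r * \1_(h @^-1` [set r]) y)%:E)).
  by apply: eq_integral => t _; rewrite fimfunE -fsumEFin.
have mI (r : R) : measurable_fun setT (fun y => r * \1_(h @^-1` [set r]) y)%R.
  exact: measurable_funM.
rewrite ge0_integral_fsum//; last 2 first.
  by move=> r; apply/measurable_EFinP.
  by move=> r y _; exact: nnfun_muleindic_ge0.
transitivity (\int[nu]_x (\sum_(r \in range h)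
    (r * \1_(h @^-1` [set r]) (phi x) * g x)%:E)); last first.
  apply: eq_integral => t _; rewrite [in RHS]fimfunE fsumEFin //; congr EFin.
  by rewrite mulr_fsuml.
have mIg (r : R) : measurable_fun setT (fun x => \1_(h @^-1` [set r]) (phi x) * g x)%R.
  apply: measurable_funM => //; apply: measurableT_comp => //.
rewrite ge0_integral_fsum//; last 2 first.
  move=> r; apply/measurable_EFinP; under eq_fun do rewrite -mulrA; exact: measurable_funM.
  by move=> r x _; rewrite EFinM mule_ge0 ?[(0 <= (g _)%:E)%E]lee_fin// nnfun_muleindic_ge0.
apply: eq_fsbigr => r /[!inE] -[y _ hy].
have r0 : (0 <= r)%R by rewrite -hy.
under eq_integral do rewrite EFinM.
rewrite ge0_integralZl_EFin//; last exact/measurable_EFinP.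
under [RHS]eq_integral do rewrite -mulrA EFinM.
rewrite ge0_integralZl_EFin//; [|by move=> *; rewrite lee_fin mulr_ge0|exact/measurable_EFinP].
by rewrite integral_indic// setIT muE.
Qed.

(** Passes from indicators to simple functions to monotone limits. It serves for independence, with
    [phi] one coordinate and [g] the product of the other factors, and for change of density, with
    [phi] the identity. *)
Lemma ge0_integral_weighted_pushforward (f : Y -> R) : measurable_fun setT f ->
  (forall y, (0 <= f y)%R) ->
  \int[mu]_y (f y)%:E = \int[nu]_x (f (phi x) * g x)%:E.
Proof.
move=> mf f0.
have mEf : measurable_fun setT (EFin \o f) by exact/measurable_EFinP.
pose h := nnsfun_approx measurableT mEf.
have ch y : (h n y)%:E @[n --> \oo] --> (f y)%:E.
  by apply: (cvg_nnsfun_approx measurableT mEf) => //= x _; rewrite lee_fin.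
transitivity (limn (fun n => \int[mu]_y (h n y)%:E)).
  rewrite -monotone_convergence//.
  - by apply: eq_integral => y _; apply/esym/cvg_lim => //; exact: ch.
  - by move=> n; exact/measurable_EFinP/measurable_funP.
  - by move=> n y _; rewrite lee_fin.
  - by move=> y _ a b ab; rewrite lee_fin; exact/lefP/nd_nnsfun_approx.
under eq_fun do rewrite nnsfun_weighted_pushforward.
rewrite -monotone_convergence//.
- apply: eq_integral => x _; apply/cvg_lim => //=.
  by under eq_fun do rewrite EFinM; rewrite EFinM; apply: cvgeZr => //; exact: ch.
- move=> n; apply/measurable_EFinP/measurable_funM => //.
  by apply: measurableT_comp.
- by move=> n x _; rewrite lee_fin mulr_ge0.
- by move=> x _ a b ab; rewrite lee_fin ler_wpM2r//; exact/lefP/nd_nnsfun_approx.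
Qed.

End weighted_pushforward.

Section bounded_expectation.
Context d (T : measurableType d) (R : realType) (P : probability T R).
Implicit Types (f g : T -> R) (M : R).

Lemma bounded_integrable f M : measurable_fun setT f -> (forall x, `|f x| <= M) ->
  P.-integrable setT (EFin \o f).
Proof.
move=> mf fM; apply: measurable_bounded_integrable => //.
  by rewrite -ge0_fin_numE// fin_num_measure.
by exists M; split; [exact: num_real|move=> y My x _; exact: le_trans (fM x) (ltW My)].
Qed.

Lemma EFin_Rintegral f : P.-integrable setT (EFin \o f) ->
  (\int[P]_x f x)%:E = (\int[P]_x (f x)%:E)%E.
Proof. by move=> fi; rewrite /Rintegral fineK//; exact: integrable_fin_num fi. Qed.

Lemma Rintegral_probability_cst r : \int[P]_x r = r.
Proof. by rewrite Rintegral_cst// [X in fine X](probability_setT P) mulr1. Qed.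

Lemma Rintegral_probability_itv f M : measurable_fun setT f -> (forall x, 0 <= f x <= M) ->
  0 <= \int[P]_x f x <= M.
Proof.
move=> mf fM; have fi : P.-integrable setT (EFin \o f).
  by apply: (@bounded_integrable _ M) => // x; have /andP[f0 f1] := fM x; rewrite ger0_norm.
rewrite Rintegral_ge0 => [|x _]; last by have /andP[] := fM x.
rewrite -[leRHS]Rintegral_probability_cst; apply: le_Rintegral => //.
  exact: (@bounded_integrable _ `|M|).
by move=> x _; have /andP[] := fM x.
Qed.

Lemma integrable_sum_EFin (I : finType) (h : I -> T -> R) :
  (forall i, P.-integrable setT (EFin \o h i)) ->
  P.-integrable setT (EFin \o (fun x => \sum_i h i x)).
Proof.
move=> hi; rewrite (_ : EFin \o _ = (fun x => \sum_i (EFin \o h i) x)%E).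
  exact: integrable_sum.
by apply/funext => x /=; rewrite sumEFin.
Qed.

Lemma Rintegral_sum (I : finType) (h : I -> T -> R) :
  (forall i, P.-integrable setT (EFin \o h i)) ->
  \int[P]_x (\sum_i h i x) = \sum_i \int[P]_x h i x.
Proof.
move=> hi; apply: EFin_inj.
rewrite -sumEFin; under [RHS]eq_bigr do rewrite EFin_Rintegral//.
rewrite -integral_sum// EFin_Rintegral; last exact: integrable_sum_EFin.
by apply: eq_integral => x _; rewrite sumEFin.
Qed.

End bounded_expectation.

(** * Expectation of a product of independent factors *)

Section independence.
Context d d' (T : measurableType d) (Z : measurableType d') (R : realType).
Variables (P : probability T R) (K : finType) (Y : K -> T -> Z).
Hypothesis mY : forall k, measurable_fun setT (Y k).
Hypothesis rectangles : forall B : K -> set Z, (forall k, measurable (B k)) ->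
  fine (P [set w | forall k, B k (Y k w)]) = \prod_k fine (P (Y k @^-1` B k)).

Let prod_itv (g : K -> Z -> R) M (s : seq K) w : (forall k y, 0 <= g k y <= M) ->
  0 <= \prod_(k <- s) g k (Y k w) <= M ^+ size s.
Proof.
move=> gM; elim: s => [|k s /andP[IH0 IH1]]; first by rewrite big_nil expr0 ler01 lexx.
have /andP[h0 h1] := gM k (Y k w).
by rewrite big_cons exprS mulr_ge0 // ler_pM.
Qed.

Let mprod (g : K -> Z -> R) (p : pred K) : (forall k, measurable_fun setT (g k)) ->
  measurable_fun setT (fun w => \prod_(k | p k) g k (Y k w)).
Proof.
move=> mg; under eq_fun do rewrite big_mkcond /=.
apply: measurable_prod => k _; case: (p k) => //.
exact: measurableT_comp.
Qed.

(* The factors are replaced one at a time: indicators generalise to nonnegative functions. *)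
Lemma Rintegral_prod_independent (g : K -> Z -> R) M :
  (forall k, measurable_fun setT (g k)) -> (forall k y, 0 <= g k y <= M) ->
  \int[P]_w (\prod_k g k (Y k w)) = \prod_k \int[P]_w g k (Y k w).
Proof.
pose ind (h : Z -> R) := exists2 B, measurable B & h = \1_B.
(* The bound must also hold for the indicators that replace factors below. *)
wlog M1 : M / 1 <= M => [wl mg gM|].
  apply: (wl (Num.max M 1)) => //; first by rewrite le_max lexx orbT.
  by move=> k y; have /andP[-> h] := gM k y; rewrite le_max h.
(* Induction on the list of factors that may be arbitrary; those off the list are indicators, and
   the empty list is the case of rectangles. *)
have : forall k, k \notin enum K -> ind (g k) by move=> k; rewrite mem_enum.
elim: (enum K) g => [|k0 s IH] g gind mg gM.
  have [B mB gB] : exists2 B : K -> set Z, forall k, measurable (B k) & forall k, g k = \1_(B k).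
    have /choice[B hB] : forall k, exists A, measurable A /\ g k = \1_A.
      by move=> k; have [A mA gA] := gind k isT; exists A.
    by exists B => k; have [] := hB k.
  have mI k : measurable (Y k @^-1` B k) by rewrite -[X in measurable X]setTI; exact: mY.
  transitivity (\prod_k fine (P (Y k @^-1` B k))); last first.
    apply: eq_bigr => k _; rewrite /Rintegral gB.
    rewrite -[X in fine (P X)]setIT -integral_indic//.
  rewrite -rectangles// -[X in fine (P X)]setIT -integral_indic//; last first.
    rewrite (_ : [set w | _] = \big[setI/setT]_(k : K) (Y k @^-1` B k)).
      exact: bigsetI_measurable.
    apply/seteqP; split => w /=.
      by move=> h; elim/big_ind : _ => // k _; exact: h.
    by rewrite -bigcap_seq => h k; exact: h k (mem_index_enum k).
  congr fine; apply: eq_integral => w _; congr EFin.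
  rewrite indicE; have [/set_mem /= h|/negP hN] := boolP (w \in _).
    by rewrite big1// => k _; rewrite gB indicE mem_set.
  have [k hk] : exists k, ~ B k (Y k w).
    by apply/existsNP => h; apply: hN; exact: mem_set.
  by rewrite (bigD1 k)//= gB indicE memNset// mul0r.
have gk0 y : 0 <= g k0 y by have /andP[] := gM k0 y.
pose g' (h : Z -> R) k := if k == k0 then h else g k.
have mg' h : measurable_fun setT h -> forall k, measurable_fun setT (g' h k).
  by move=> mh k; rewrite /g'; case: ifP.
have g'M h : (forall y, 0 <= h y <= M) -> forall k y, 0 <= g' h k y <= M.
  by move=> hM k y; rewrite /g'; case: ifP.
pose W w := \prod_(k | k != k0) g k (Y k w).
have prodE h w : \prod_k g' h k (Y k w) = h (Y k0 w) * W w.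
  rewrite (bigD1 k0)//= /g' eqxx; congr (_ * _).
  by apply: eq_bigr => k /negbTE ->.
have W0 w : 0 <= W w by apply: prodr_ge0 => k _; have /andP[] := gM k (Y k w).
have mW : measurable_fun setT W by exact: mprod.
pose c := \prod_(k | k != k0) \int[P]_w g k (Y k w).
have c0 : 0 <= c.
  by apply: prodr_ge0 => k _; apply: Rintegral_ge0 => w _; have /andP[] := gM k (Y k w).
(* With the other factors fixed, weighting by [W] gives [Y k0] the measure [c] times its law: on
   sets this is the induction hypothesis with an indicator at [k0]. *)
have IHA A : measurable A ->
    (c%:E * P (Y k0 @^-1` A) = \int[P]_w (\1_A (Y k0 w) * W w)%:E)%E.
  move=> mA; have mIA : measurable_fun setT (\1_A : Z -> R) by [].
  have IA y : 0 <= (\1_A : Z -> R) y <= M.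
    by rewrite !indicE; case: (y \in A); rewrite ?ler01 ?lexx ?M1 ?(le_trans ler01 M1).
  have /IH/(_ (mg' _ mIA) (g'M _ IA)) : forall k, k \notin s -> ind (g' \1_A k).
    move=> k ks; rewrite /g'; case: eqP => [_|/eqP kk0]; first by exists A.
    by apply: gind; rewrite inE negb_or kk0.
  rewrite (bigD1 k0)//= {2}/g' eqxx => IHA.
  have PE : \int[P]_w \1_A (Y k0 w) = fine (P (Y k0 @^-1` A)).
    rewrite /Rintegral -[X in fine (P X)]setIT -integral_indic//.
    by rewrite -[X in measurable X]setTI; exact: mY.
  rewrite -[P _]fineK ?fin_num_measure// -?PE; last first.
    by rewrite -[X in measurable X]setTI; exact: mY.
  rewrite -EFinM -EFin_Rintegral; last first.
    apply: (@bounded_integrable _ _ _ _ _ (M ^+ size (index_enum K))).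
      by apply: measurable_funM => //; exact: measurableT_comp.
    move=> w; rewrite -prodE ger0_norm; have /andP[//] := prod_itv (index_enum K) w (g'M _ IA).
  congr EFin; rewrite mulrC /c.
  transitivity (\int[P]_w (\prod_k g' \1_A k (Y k w))); last first.
    by apply: eq_Rintegral => w _; rewrite prodE.
  rewrite IHA; congr (_ * _); apply: eq_bigr => k /negbTE kk0.
  by apply: eq_Rintegral => w _; rewrite /g' kk0.
have E : g =1 g' (g k0) by move=> k; rewrite /g'; case: eqP => // ->.
have gE w : \prod_k g k (Y k w) = g k0 (Y k0 w) * W w.
  by rewrite -prodE; apply: eq_bigr => k _; rewrite E.
have mu_meas := @ge0_integral_weighted_pushforward _ _ T Z R P
  (mscale (NngNum c0) (pushforward P (Y k0))) (Y k0) W (mY k0) mW W0.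
rewrite /Rintegral; under eq_integral do rewrite gE.
rewrite -mu_meas//.
- rewrite ge0_integral_mscale//=; last 2 first.
  + exact/measurable_EFinP.
  + by move=> y _; rewrite lee_fin.
  rewrite ge0_integral_pushforward//; last 2 first.
  + exact/measurable_EFinP.
  + by move=> y _; rewrite lee_fin.
  rewrite (bigD1 k0)//= -/c preimage_setT fineM//=; first by rewrite mulrC.
  have := @bounded_integrable _ _ _ P (g k0 \o Y k0) M.
  move=> /(_ (measurableT_comp (mg k0) (mY k0))) hi.
  apply: (integrable_fin_num _ (hi _)) => // w /=.
  by rewrite ger0_norm//; have /andP[] := gM k0 (Y k0 w).
Qed.

End independence.

(** * The Donsker-Varadhan inequality *)

Section donsker_varadhan.
Context d (T : measurableType d) (R : realType).

(* Comparing positive and negative parts separately covers infinite integrals. *)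
Lemma le_integral_measurable (mu : {measure set T -> \bar R}) (f g : T -> \bar R) :
  measurable_fun setT f -> measurable_fun setT g -> (forall x, f x <= g x)%E ->
  (\int[mu]_x f x <= \int[mu]_x g x)%E.
Proof.
move=> mf mg fg; rewrite integralE [leRHS]integralE leeB//.
- apply: ge0_le_integral => //; [exact: measurable_funepos|exact: measurable_funepos|].
  by move=> x _; rewrite !funeposE ge_max !le_max fg lexx orbT.
- apply: ge0_le_integral => //; [exact: measurable_funeneg|exact: measurable_funeneg|].
  by move=> x _; rewrite !funenegE ge_max !le_max leeN2 fg lexx orbT.
Qed.

(* Fenchel-Young for [x ln x - x], whose conjugate is [exp]. *)
Lemma xlnx_young (x t : R) : 0 <= x -> x * t <= x * ln x - x + expR t.
Proof.
rewrite le_eqVlt => /predU1P[<-|x0]; first by rewrite !mul0r subr0 add0r expR_ge0.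
have := expR_ge1Dx (t - ln x : R).
rewrite expRD expRN lnK ?posrE// => /(ler_wpM2l (ltW x0)).
rewrite mulrCA divff ?gt_eqF// mulr1; lra.
Qed.

(** Apply [xlnx_young] pointwise at [x = g], [t = phi - ln C] and integrate under [P]: the terms
    [- g] and [exp phi / C] contribute -1 and at most 1. *)
Lemma donsker_varadhan (P Q : probability T R) (phi : T -> R) (M C : R) :
  measurable_fun setT phi -> (forall x, `|phi x| <= M) ->
  (\int[P]_x (expR (phi x))%:E <= C%:E)%E -> 0 < C ->
  ((\int[Q]_x phi x)%:E <= KL Q P + (ln C)%:E)%E.
Proof.
move=> mphi phiM hC C0; rewrite /KL; case: pselect => [H|_]; last by rewrite addye// leey.
case: cid => g /= [mg [g0 QE]]; set c := ln C.
(* The change of density is available for nonnegative functions, hence the shift by [M]. *)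
have phi0 x : 0 <= phi x + M by have := phiM x; rewrite ler_norml => /andP[]; lra.
have mphiM : measurable_fun setT (fun x => phi x + M) by exact: measurable_funD.
have mexp : measurable_fun setT (fun x => expR (phi x)).
  by apply: measurableT_comp mphi; exact: measurable_expR.
have QgE A : measurable A -> Q A = (\int[P]_x (\1_A (id x) * g x)%:E)%E.
  move=> mA; rewrite QE// integral_mkcond; apply: eq_integral => x _ /=.
  by rewrite patchE indicE; case: ifP; rewrite ?mul1r ?mul0r.
have mid : measurable_fun setT (@id T) by [].
have change f := @ge0_integral_weighted_pushforward _ _ T T R P Q id g mid mg g0 QgE f.
have intg : P.-integrable setT (EFin \o g).
  apply/integrableP; split; first exact/measurable_EFinP.
  under eq_integral do rewrite /= ger0_norm//.
  by rewrite -QE// probability_setT ltry.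
have Eg : \int[P]_x g x = 1 by rewrite /Rintegral -QE// probability_setT.
have intphiQ : Q.-integrable setT (EFin \o (fun x => phi x + M)).
  apply: (@bounded_integrable _ _ _ _ _ (M + M)) => // x.
  by rewrite (le_trans (ler_normD _ _))// lerD// ger0_norm// (le_trans _ (phiM x)).
have intphig : P.-integrable setT (EFin \o (fun x => (phi x + M) * g x)).
  apply/integrableP; split; first exact/measurable_EFinP/measurable_funM.
  under eq_integral do rewrite /= ger0_norm ?mulr_ge0//.
  by rewrite -change// -EFin_Rintegral// ltry.
have Ephi : \int[P]_x ((phi x + M) * g x) = \int[Q]_x phi x + M.
  rewrite /Rintegral -change//.
  rewrite -[fine _]/(\int[Q]_x (phi x + M)) RintegralD// ?Rintegral_probability_cst//.
    exact: (@bounded_integrable _ _ _ _ _ M).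
  exact: (@bounded_integrable _ _ _ _ _ `|M|).
have intexp : P.-integrable setT (EFin \o (fun x => expR (phi x) / C)).
  apply: (@bounded_integrable _ _ _ _ _ (expR M / C)).
    by apply: measurable_funM.
  move=> x; rewrite ger0_norm ?divr_ge0 ?expR_ge0 ?(ltW C0)//.
  by rewrite ler_wpM2r ?invr_ge0 ?(ltW C0)// ler_expR (le_trans (ler_norm _)).
have Eexp : \int[P]_x (expR (phi x) / C) <= 1.
  rewrite RintegralZr//; last first.
    apply: (@bounded_integrable _ _ _ _ _ (expR M)) => // x.
    by rewrite ger0_norm ?expR_ge0// ler_expR (le_trans (ler_norm _)).
  rewrite ler_pdivrMr// mul1r -lee_fin EFin_Rintegral//.
  apply: (@bounded_integrable _ _ _ _ _ (expR M)) => // x.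
  by rewrite ger0_norm ?expR_ge0// ler_expR (le_trans (ler_norm _)).
(* Equal to [g (phi - c) + g - exp phi / C]: an integrable minorant of [g ln g], whose own integral
   may be infinite. *)
pose k x := (phi x + M) * g x + (1 - c - M) * g x - expR (phi x) / C.
have intk1 : P.-integrable setT (EFin \o (fun x => (1 - c - M) * g x)).
  rewrite (_ : EFin \o _ = fun x => ((1 - c - M)%:E * (EFin \o g) x)%E) //.
  exact: integrableZl.
have intk2 : P.-integrable setT (EFin \o (fun x => (phi x + M) * g x + (1 - c - M) * g x)).
  exact: (integrableD measurableT intphig intk1).
have intk : P.-integrable setT (EFin \o k) by exact: (integrableB measurableT intk2 intexp).
have Ek : \int[Q]_x phi x - c <= \int[P]_x k x.
  by rewrite RintegralB// RintegralD// RintegralZl// Eg Ephi; lra.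
have kle x : k x <= g x * ln (g x).
  have := @xlnx_young (g x) (phi x - c) (g0 x).
  by rewrite expRB lnK ?posrE// /k; lra.
rewrite -leeBlDr// -EFinB (le_trans (y := (\int[P]_x k x)%:E)) ?lee_fin//.
rewrite EFin_Rintegral//; apply: le_integral_measurable => [||x].
- exact: measurable_int intk.
- by apply/measurable_EFinP/measurable_funM => //; exact: measurableT_comp (@measurable_ln R) mg.
- by rewrite lee_fin.
Qed.

End donsker_varadhan.

(** * The exponential moment *)

Lemma Rintegral_law d d' (T1 : measurableType d) (T2 : measurableType d') (R : realType)
    (P : probability T1 R) (P' : probability T2 R) (X : T1 -> T2) (h : T2 -> R) :
  measurable_fun setT X -> (forall A, measurable A -> P (X @^-1` A) = P' A) ->
  measurable_fun setT h -> (forall y, 0 <= h y) ->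
  \int[P]_x h (X x) = \int[P']_y h y.
Proof.
move=> mX law mh h0; congr fine; apply/esym.
transitivity (\int[pushforward P X]_y (h y)%:E)%E.
  by apply: eq_measure_integral => A mA _; exact/esym/law.
rewrite (ge0_integral_pushforward mX)//.
- exact/measurable_EFinP.
- by move=> y _; rewrite lee_fin.
Qed.

(** Distributivity with index types that depend on the factor, since the tasks have samples of
    different sizes. *)
Lemma prodr_sum_fprod (R : comNzRingType) (I : finType) (T_ : I -> finType)
    (F : forall i, T_ i -> R) :
  \prod_i \sum_(A : T_ i) F i A = \sum_(t : fprod T_) \prod_i F i (t i).
Proof.
pose P_ i : {ffun T_ i -> R} := [ffun A => F i A].
transitivity (\sum_(t : fprod T_) \prod_i P_ i (t i)); last first.
  by apply: eq_bigr => t _; apply: eq_bigr => i _; rewrite ffunE.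
rewrite (big_fprod _ _ P_) -(bigA_distr_big_dep _ (fun i j => untag 0 (P_ i) j)).
apply: eq_bigr => i _; rewrite -(big_tag (fun i => P_ i)).
by apply: eq_bigr => A _; rewrite ffunE.
Qed.

Section iid_moments.
Context d0 d' (Omega : measurableType d0) (Z : measurableType d') (R : realType).
Variables (Pr : probability Omega R) (n : nat) (m : 'I_n -> nat).
Variables (D : 'I_n -> probability Z R) (z : 'I_n -> nat -> Omega -> Z).
Hypothesis hz : iid_samples Pr m D z.

Lemma iid_measurable i j : measurable_fun setT (z i j).
Proof. by case: hz. Qed.

Lemma iid_integral i j (h : Z -> R) : (j < m i)%N -> measurable_fun setT h ->
  (forall y, 0 <= h y) -> \int[Pr]_w h (z i j w) = \int[D i]_y h y.
Proof.
move=> jm mh h0; have [_ [law _]] := hz.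
by apply: Rintegral_law => //; [exact: iid_measurable|exact: law].
Qed.

(** One finite index type for the samples of all tasks, so that independence is used once for the
    whole family. *)
Let K := {i : 'I_n & 'I_(m i)}.
Let Y (k : K) : Omega -> Z := z (tag k) (tagged k).

Let iid_rectangles (B : K -> set Z) : (forall k, measurable (B k)) ->
  fine (Pr [set w | forall k, B k (Y k w)]) = \prod_k fine (Pr (Y k @^-1` B k)).
Proof.
move=> mB; have [_ [_ indep]] := hz.
(* [iid_samples] indexes samples by all naturals, so [B] is padded with [setT] beyond [m i]. *)
pose B' i j := if @insub _ _ 'I_(m i) j is Some j' then B (Tagged (fun i => 'I_(m i)) j') else setT.
have B'E i (j : 'I_(m i)) : B' i j = B (Tagged (fun i => 'I_(m i)) j).
  by rewrite /B' valK.
have mB' i j : measurable (B' i j) by rewrite /B'; case: insub.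
have -> : [set w | forall k, B k (Y k w)] =
    [set w | forall i : 'I_n, forall j, (j < m i)%N -> B' i j (z i j w)].
  apply/seteqP; split => w /= h.
    by move=> i j jm; have := B'E i (Ordinal jm) => /= ->; exact: (h (Tagged _ (Ordinal jm))).
  by case=> i j; rewrite -B'E; exact: h.
rewrite indep//= (sig_big_dep _ _ (fun i j => fine (Pr (z i (nat_of_ord j) @^-1` B' i j)))) /=.
by apply: eq_bigr => -[i j] _; rewrite /= B'E.
Qed.

Variable g : 'I_n -> Z -> R.
Hypotheses (mg : forall i, measurable_fun setT (g i)) (g01 : forall i y, 0 <= g i y <= 1).
Let p i := \int[D i]_y g i y.

Let p01 i : 0 <= p i <= 1.
Proof. exact: Rintegral_probability_itv. Qed.

Let mlr i b : measurable_fun setT (fun y => lratio (p i) (g i y) b).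
Proof.
by rewrite /lratio; case: b; apply: measurable_funM => //; exact: measurable_funB.
Qed.

Let lr_itv i b y : 0 <= lratio (p i) (g i y) b <= (p i)^-1 + (1 - p i)^-1.
Proof.
have /andP[p0 p1] := p01 i; have /andP[y0 y1] := g01 i y.
have i0 : 0 <= (p i)^-1 by rewrite invr_ge0.
have i1 : 0 <= (1 - p i)^-1 by rewrite invr_ge0 subr_ge0.
rewrite lratio_ge0//= /lratio; case: b.
  by rewrite ler_wpDr// ler_piMl.
by rewrite ler_wpDl// ler_piMl// gerBl.
Qed.

(** The mean is [p / p] or [(1 - p) / (1 - p)]: 1, or 0 when the denominator vanishes. *)
Let E_lr i b : \int[D i]_y lratio (p i) (g i y) b <= 1.
Proof.
have ig : (D i).-integrable setT (EFin \o g i).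
  by apply: (@bounded_integrable _ _ _ _ _ 1) => // y; have /andP[h0 h1] := g01 i y; rewrite ger0_norm.
have ic : (D i).-integrable setT (EFin \o (cst 1 : Z -> R)).
  by apply: (@bounded_integrable _ _ _ _ _ 1) => // y; rewrite normr1.
have frac1 (x : R) : x / x <= 1 by have [->|x0] := eqVneq x 0; rewrite ?mul0r ?ler01// divff.
rewrite /lratio; case: b; first by rewrite RintegralZr// frac1.
rewrite RintegralZr//; last exact: (integrableB measurableT ic ig).
by rewrite RintegralB// Rintegral_probability_cst frac1.
Qed.

Let mixed_ratio_prod w : \prod_i mixed_ratio (p i) (fun j : 'I_(m i) => g i (z i j w)) =
  \sum_(t : fprod (fun i => {set 'I_(m i)} : finType))
    (\prod_i maxlik R (m i) #|t i|) *
    \prod_(k : K) lratio (p (tag k)) (g (tag k) (Y k w)) (tagged k \in t (tag k)).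
Proof.
rewrite /mixed_ratio prodr_sum_fprod; apply: eq_bigr => t _.
rewrite big_split/=; congr (_ * _).
by rewrite (sig_big_dep _ _ (fun i j => lratio (p i) (g i (z i (nat_of_ord j) w)) (j \in t i))).
Qed.

(** Each term of the expansion carries a product of independent likelihood ratios of mean at most 1,
    so the weights alone remain and factor back into one sum per task. *)
Lemma integral_prod_mixed_ratio_le :
  (\int[Pr]_w (\prod_i mixed_ratio (p i) (fun j : 'I_(m i) => g i (z i j w)))%:E <=
  (\prod_i \sum_(k < (m i).+1) maxlik R (m i) k *+ 'C(m i, k))%:E)%E.
Proof.
pose M := \sum_i ((p i)^-1 + (1 - p i)^-1).
have M0 i : 0 <= (p i)^-1 + (1 - p i)^-1.
  by have /andP[p0 p1] := p01 i; rewrite addr_ge0// invr_ge0// subr_ge0.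
have lrM i b y : 0 <= lratio (p i) (g i y) b <= M.
  have /andP[-> h] := lr_itv i b y; rewrite (le_trans h)// /M (bigD1 i)//=.
  by rewrite lerDl sumr_ge0.
pose G (t : fprod (fun i => {set 'I_(m i)} : finType)) (k : K) (y : Z) :=
  lratio (p (tag k)) (g (tag k) y) (tagged k \in t (tag k)).
have GM t k y : 0 <= G t k y <= M by exact: lrM.
have mG t k : measurable_fun setT (G t k) by exact: mlr.
have mYk k : measurable_fun setT (Y k) by exact: iid_measurable.
have mprod t : measurable_fun setT (fun w => \prod_(k : K) G t k (Y k w)).
  by apply: measurable_prod => k _; exact: measurableT_comp.
have iprod t : Pr.-integrable setT (EFin \o (fun w => \prod_(k : K) G t k (Y k w))).
  apply: (@bounded_integrable _ _ _ _ _ (\prod_(k : K) M)) => // w.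
  rewrite ger0_norm; first by apply: ler_prod => k _; exact: GM.
  by apply: prodr_ge0 => k _; have /andP[] := GM t k (Y k w).
have iterm (t : fprod (fun i => {set 'I_(m i)} : finType)) : Pr.-integrable setT
    (EFin \o (fun w => (\prod_i maxlik R (m i) #|t i|) * \prod_(k : K) G t k (Y k w))).
  exact: (integrableZl measurableT _ (iprod t)).
under eq_integral do rewrite mixed_ratio_prod.
rewrite -EFin_Rintegral; last exact: integrable_sum_EFin.
rewrite lee_fin Rintegral_sum//.
under [leRHS]eq_bigr do rewrite -sum_mixed_weights.
rewrite prodr_sum_fprod; apply: ler_sum => t _.
rewrite RintegralZl//; last exact: iprod.
rewrite ler_piMr//; first by apply: prodr_ge0 => i _; exact: maxlik_ge0.
rewrite (Rintegral_prod_independent mYk iid_rectangles (mG t) (GM t)).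
apply: prodr_ile1 => k _; apply/andP; split.
  by apply: Rintegral_ge0 => w _; have /andP[] := GM t k (Y k w).
rewrite iid_integral//; first exact: E_lr.
by move=> y; have /andP[] := GM t k y.
Qed.

End iid_moments.

(** * Measurability, and expectations of tangents *)

Section measurability.
Context d (T : measurableType d) (R : realType).

(** The inverse is [exp (- ln f)], cut off by an indicator at 0 to match [0^-1 = 0]. *)
Lemma measurable_inv_ge0 (f : T -> R) : measurable_fun setT f -> (forall x, 0 <= f x) ->
  measurable_fun setT (fun x => (f x)^-1).
Proof.
move=> mf f0.
rewrite (_ : (fun x => _) = (fun x => \1_(~` [set 0]) (f x) * expR (- ln (f x)))).
  apply: measurable_funM.
    apply: measurableT_comp mf; apply: measurable_indic; exact: measurableC.
  apply: measurableT_comp; first exact: measurable_expR.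
  by apply: measurable_funN; apply: measurableT_comp mf; exact: measurable_ln.
apply/funext => x; rewrite indicE; have [fx0|fx0] := eqVneq (f x) 0.
  by rewrite fx0 invr0 memNset ?mul0r//= => /(_ erefl).
rewrite mem_set /=; last exact/eqP.
by rewrite mul1r expRN lnK// posrE lt_neqAle eq_sym fx0 f0.
Qed.

Lemma measurable_mixed_ratio m (p : T -> R) (x : 'I_m -> T -> R) :
  measurable_fun setT p -> (forall t, 0 <= p t <= 1) -> (forall j, measurable_fun setT (x j)) ->
  measurable_fun setT (fun t => mixed_ratio (p t) (x ^~ t)).
Proof.
move=> mp p01 mx; apply: measurable_sum => A; apply: measurable_funM => //.
apply: measurable_prod => j _; rewrite /lratio; case: (j \in A); apply: measurable_funM => //.
- by apply: measurable_inv_ge0 => // t; have /andP[] := p01 t.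
- exact: measurable_funB.
- apply: measurable_inv_ge0 => [|t]; first exact: measurable_funB.
  by rewrite subr_ge0; have /andP[] := p01 t.
Qed.

Lemma measurable_kl_tangent (u v : R) (q p : T -> R) :
  measurable_fun setT q -> measurable_fun setT p ->
  measurable_fun setT (fun t => kl_tangent u v (q t) (p t)).
Proof.
move=> mq mp; apply: measurable_funB.
  apply: measurable_funD => //; apply: measurable_funD; apply: measurable_funM => //.
  exact: measurable_funB.
apply: measurable_funD; apply: measurable_funM => //; exact: measurable_funB.
Qed.

Lemma kl_tangent_bound (u v q p : R) : 0 < u -> 0 < v -> 0 <= q <= 1 -> 0 <= p <= 1 ->
  `|kl_tangent u v q p| <= `|ln u| + `|ln v| + 1 + u + v.
Proof.
move=> u0 v0 /andP[q0 q1] /andP[p0 p1]; rewrite /kl_tangent.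
have h1 : `|q * ln u| <= `|ln u| by rewrite normrM ger0_norm// ler_piMl.
have h2 : `|(1 - q) * ln v| <= `|ln v|.
  by rewrite normrM ger0_norm ?subr_ge0// ler_piMl// gerBl.
have h3 : 0 <= p * u + (1 - p) * v <= u + v by nra.
by move: h1 h2 h3; rewrite !ler_norml => /andP[? ?] /andP[? ?] /andP[? ?]; lra.
Qed.

Lemma Rintegral_kl_tangent (P : probability T R) (u v : R) (q p : T -> R) :
  measurable_fun setT q -> (forall t, 0 <= q t <= 1) ->
  measurable_fun setT p -> (forall t, 0 <= p t <= 1) ->
  \int[P]_t kl_tangent u v (q t) (p t) = kl_tangent u v (\int[P]_t q t) (\int[P]_t p t).
Proof.
move=> mq q01 mp p01.
have kE x y : kl_tangent u v x y = (ln u - ln v) * x + (v - u) * y + (ln v + 1 - v).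
  by rewrite /kl_tangent; ring.
have ib (f : T -> R) c : measurable_fun setT f -> (forall t, 0 <= f t <= 1) ->
    P.-integrable setT (EFin \o (fun t => c * f t)).
  move=> mf f01; apply: (@bounded_integrable _ _ _ _ _ `|c|); first exact: measurable_funM.
  by move=> t; have /andP[f0 f1] := f01 t; rewrite normrM (ger0_norm f0) ler_piMr.
have ib1 (f : T -> R) : measurable_fun setT f -> (forall t, 0 <= f t <= 1) ->
    P.-integrable setT (EFin \o f).
  by move=> mf f01; have := ib f 1 mf f01; under eq_fun do rewrite mul1r.
rewrite kE; under eq_Rintegral do rewrite kE.
rewrite RintegralD//; last 2 first.
- exact: (integrableD measurableT (ib q _ mq q01) (ib p _ mp p01)).
- by apply: (@bounded_integrable _ _ _ _ _ `|ln v + 1 - v|).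
rewrite Rintegral_probability_cst RintegralD//; [|exact: ib|exact: ib].
by rewrite !RintegralZl//; exact: ib1.
Qed.

Lemma sum_kl_tangent m (u v p : R) (x : 'I_m -> R) : (0 < m)%N ->
  \sum_j kl_tangent u v (x j) p = m%:R * kl_tangent u v (m%:R^-1 * \sum_j x j) p.
Proof.
move=> m0; have mN0 : m%:R != 0 :> R by rewrite pnatr_eq0 -lt0n.
have kE y : kl_tangent u v y p = (ln u - ln v) * y + ((v - u) * p + (ln v + 1 - v)).
  by rewrite /kl_tangent; ring.
under eq_bigr do rewrite kE.
by rewrite kE big_split/= -mulr_sumr sumr_const card_ord -[_ *+ m]mulr_natl; field.
Qed.

End measurability.

(* Vanishes exactly when [p = 0] forces [x = 0] and [p = 1] forces [x = 1], as [0 / 0 = 0]. *)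
Definition degeneracy (R : realType) (p x : R) : R :=
  (1 - p / p) * x + (1 - (1 - p) / (1 - p)) * (1 - x).

Section degeneracy_theory.
Variable R : realType.
Implicit Types p x : R.

Let frac1 p : p / p <= 1.
Proof. by have [->|x0] := eqVneq p 0; rewrite ?mul0r ?ler01// divff. Qed.

Lemma degeneracy_ge0 p x : 0 <= x <= 1 -> 0 <= degeneracy p x.
Proof.
by move=> /andP[x0 x1]; rewrite /degeneracy addr_ge0// mulr_ge0// subr_ge0.
Qed.

Lemma degeneracy_eq0 p x : 0 <= x <= 1 -> degeneracy p x = 0 ->
  (p = 0 -> x = 0) /\ (p = 1 -> x = 1).
Proof.
move=> /andP[x0 x1]; rewrite /degeneracy => h; split => pE; move: h; rewrite pE.
  by rewrite mul0r !subr0 mul1r divff ?oner_eq0// subrr mul0r addr0.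
by rewrite divff ?oner_eq0// subrr !mul0r subr0 add0r mul1r => /eqP; rewrite subr_eq0 => /eqP.
Qed.

(** As [degeneracy] is affine in [x], this is its expectation when [x] has mean [p]. *)
Lemma degeneracy_self p : degeneracy p p = 0.
Proof.
have frac0 y : (1 - y / y) * y = 0 :> R.
  by have [->|y0] := eqVneq y 0; rewrite ?mulr0// divff// subrr mul0r.
by rewrite /degeneracy !frac0 addr0.
Qed.

End degeneracy_theory.

(** * The high-probability event *)

Section good_event.
Context dF dZ dO dT (F : measurableType dF) (Z : measurableType dZ)
  (Omega : measurableType dO) (T : measurableType dT) (R : realType).
Variables (n : nat) (m : 'I_n -> nat) (D : 'I_n -> probability Z R).
Variable l : 'I_n -> F -> Z -> R.
Hypothesis m_gt0 : forall i, (0 < m i)%N.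
Hypothesis ml : forall i, measurable_fun setT (fun p : F * Z => l i p.1 p.2).
Hypothesis l01 : forall i f y, 0 <= l i f y <= 1.

Definition risk i f : R := \int[D i]_y l i f y.

Lemma measurable_loss i f : measurable_fun setT (l i f).
Proof. exact: (measurableT_comp (ml i) (pair1_measurable f)). Qed.

Lemma measurable_loss_at i y : measurable_fun setT (l i ^~ y).
Proof. exact: (measurableT_comp (ml i) (pair2_measurable y)). Qed.

Lemma risk01 i f : 0 <= risk i f <= 1.
Proof. by apply: Rintegral_probability_itv => //; exact: measurable_loss. Qed.

Lemma measurable_risk i : measurable_fun setT (risk i).
Proof.
apply/measurable_EFinP.
rewrite (_ : EFin \o _ = fun f => \int[D i]_y (l i f y)%:E)%E; last first.
  apply/funext => f /=; rewrite EFin_Rintegral//.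
  apply: (@bounded_integrable _ _ _ _ _ 1) => [|y]; first exact: measurable_loss.
  by have /andP[h0 h1] := l01 i f y; rewrite ger0_norm.
apply: (measurable_fun_fubini_tonelli_F (fun p : F * Z => (l i p.1 p.2)%:E)).
  exact/measurable_EFinP.
by move=> x; rewrite lee_fin; have /andP[] := l01 i x.1 x.2.
Qed.

Variables (Pr : probability Omega R) (z : 'I_n -> nat -> Omega -> Z).
Hypothesis hz : iid_samples Pr m D z.
Variables (P : probability T R) (e : 'I_n -> T -> F).
Hypothesis me : forall i, measurable_fun setT (e i).

(** Samples and predictors are paired in one product space, for Tonelli to exchange them. *)
Let x i j (y : Omega * T) := l i (e i y.2) (z i j y.1).
Let p i (y : Omega * T) := risk i (e i y.2).

Let mx i j : measurable_fun setT (x i j).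
Proof.
apply: (@measurableT_comp _ _ _ _ _ _ (fun q : F * Z => l i q.1 q.2) _
  (fun y : Omega * T => (e i y.2, z i j y.1)) (ml i)).
apply: measurable_fun_pair.
  exact: (measurableT_comp (me i)).
exact: (measurableT_comp (iid_measurable hz i j)).
Qed.

Let mp i : measurable_fun setT (p i).
Proof.
apply: (measurableT_comp (measurable_risk i)).
exact: (measurableT_comp (me i)).
Qed.

Let ratio (y : Omega * T) : R := \prod_i mixed_ratio (p i y) (fun j : 'I_(m i) => x i j y).
Let degen (y : Omega * T) : R := \sum_i \sum_(j < m i) degeneracy (p i y) (x i j y).
(* The infinite term discards samples that contradict a risk equal to 0 or 1. *)
Let bound (y : Omega * T) : \bar R := ((ratio y)%:E + +oo * (degen y)%:E)%E.

Let mratio : measurable_fun setT ratio.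
Proof.
apply: measurable_prod => i _; apply: measurable_mixed_ratio => // t; exact: risk01.
Qed.

Let mdegen : measurable_fun setT degen.
Proof.
have minv (f : Omega * T -> R) : measurable_fun setT f -> (forall y, 0 <= f y) ->
    measurable_fun setT (fun y => 1 - f y / f y).
  move=> mf f0; apply: measurable_funB => //; apply: measurable_funM => //.
  exact: measurable_inv_ge0.
apply: measurable_sum => i; apply: measurable_sum => j.
have mp' : measurable_fun setT (fun y => 1 - p i y) by exact: measurable_funB.
apply: measurable_funD; apply: measurable_funM => //.
- by apply: minv => // y; have /andP[] := risk01 i (e i y.2).
- by apply: minv => // y; rewrite subr_ge0; have /andP[] := risk01 i (e i y.2).
- exact: measurable_funB.
Qed.

Let ratio_ge0 y : 0 <= ratio y.
Proof.
apply: prodr_ge0 => i _; apply: sumr_ge0 => A _; rewrite mulr_ge0 ?maxlik_ge0//.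
by apply: prodr_ge0 => j _; apply: lratio_ge0; [exact: risk01|exact: l01].
Qed.

Let degen_ge0 y : 0 <= degen y.
Proof. by apply: sumr_ge0 => i _; apply: sumr_ge0 => j _; exact/degeneracy_ge0/l01. Qed.

Let bound_ge0 y : (0 <= bound y)%E.
Proof. by rewrite adde_ge0// ?mule_ge0 ?lee_fin// leey. Qed.

Let mbound : measurable_fun setT bound.
Proof.
apply: emeasurable_funD; first exact/measurable_EFinP.
exact/measurable_funeM/measurable_EFinP.
Qed.

Let mxt t i j : measurable_fun setT (fun w => x i j (w, t)).
Proof. exact: (measurableT_comp (mx i j) (pair2_measurable t)). Qed.

Let E_degen t : (\int[Pr]_w (degen (w, t))%:E = 0)%E.
Proof.
have ix i j : Pr.-integrable setT (EFin \o (fun w => x i j (w, t))).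
  apply: (@bounded_integrable _ _ _ _ _ 1) => // w.
  by have /andP[h0 h1] := l01 i (e i t) (z i j w); rewrite ger0_norm.
have icst (c : R) : Pr.-integrable setT (EFin \o (cst c : Omega -> R)).
  by apply: (@bounded_integrable _ _ _ _ _ `|c|).
have E1 i (j : 'I_(m i)) : \int[Pr]_w x i j (w, t) = risk i (e i t).
  by apply: (iid_integral hz (ltn_ord j)); [exact: measurable_loss|
     move=> y; have /andP[] := l01 i (e i t) y].
have iZ c i j : Pr.-integrable setT (EFin \o (fun w => c * x i j (w, t))).
  exact: (integrableZl measurableT c (ix i j)).
have iB i j : Pr.-integrable setT (EFin \o (fun w => 1 - x i j (w, t))).
  exact: (integrableB measurableT (icst 1) (ix i j)).
have iBZ c i j : Pr.-integrable setT (EFin \o (fun w => c * (1 - x i j (w, t)))).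
  exact: (integrableZl measurableT c (iB i j)).
have id i j : Pr.-integrable setT (EFin \o (fun w => degeneracy (p i (w, t)) (x i j (w, t)))).
  pose r := risk i (e i t).
  exact: (integrableD measurableT (iZ (1 - r / r) i j) (iBZ (1 - (1 - r) / (1 - r)) i j)).
have irow i : Pr.-integrable setT
    (EFin \o (fun w => \sum_(j < m i) degeneracy (p i (w, t)) (x i j (w, t)))).
  exact: integrable_sum_EFin.
have isum : Pr.-integrable setT (EFin \o (fun w => degen (w, t))).
  exact: integrable_sum_EFin.
rewrite -EFin_Rintegral// Rintegral_sum// big1// => i _.
rewrite Rintegral_sum// big1// => j _.
pose r := risk i (e i t).
rewrite -[LHS]/(\int[Pr]_w ((1 - r / r) * x i j (w, t) +
  (1 - (1 - r) / (1 - r)) * (1 - x i j (w, t)))).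
rewrite RintegralD// !RintegralZl// RintegralB//; last exact: icst.
rewrite Rintegral_probability_cst E1.
exact: degeneracy_self.
Qed.

Let W : R := \prod_i (2 * Num.sqrt (m i)%:R).

(** For fixed predictors the infinite term has expectation [+oo * 0 = 0], and the ratio is
    controlled by the binomial sums. *)
Let E_bound t : (\int[Pr]_w bound (w, t) <= W%:E)%E.
Proof.
have mrt : measurable_fun setT (fun w => ratio (w, t)).
  exact: (measurableT_comp mratio (pair2_measurable t)).
have mdt : measurable_fun setT (fun w => degen (w, t)).
  exact: (measurableT_comp mdegen (pair2_measurable t)).
rewrite ge0_integralD//; last 4 first.
- by move=> w _; rewrite lee_fin.
- exact/measurable_EFinP.
- by move=> w _; rewrite mule_ge0 ?leey ?lee_fin.
- exact/measurable_funeM/measurable_EFinP.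
rewrite ge0_integralZl//; last 2 first.
- exact/measurable_EFinP.
- by move=> w _; rewrite lee_fin.
rewrite E_degen mule0 adde0.
have h := integral_prod_mixed_ratio_le hz (fun i => measurable_loss i (e i t))
  (fun i => l01 i (e i t)).
apply: (le_trans h).
rewrite lee_fin; apply: ler_prod => i _; rewrite sum_maxlik_le// andbT.
by apply: sumr_ge0 => k _; rewrite mulrn_wge0 ?maxlik_ge0.
Qed.

(** Either [degen] is positive and the bound is infinite, or every [degeneracy] vanishes and
    [expR_sum_tangent_le] applies to each task. *)
Let expR_le_bound w t (u v : 'I_n -> R) : (forall i, 0 < u i) -> (forall i, 0 < v i) ->
  ((expR (\sum_i \sum_(j < m i) kl_tangent (u i) (v i) (x i j (w, t)) (p i (w, t))))%:E
    <= bound (w, t))%E.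
Proof.
move=> u0 v0; rewrite /bound; have [d0|dN0] := eqVneq (degen (w, t)) 0; last first.
  rewrite mulyr gtr0_sg ?mul1e ?addey ?leey//.
  by rewrite lt_neqAle eq_sym dN0 degen_ge0.
rewrite d0 mule0 adde0 lee_fin expR_sum; apply: ler_prod => i _.
have dij (j : 'I_(m i)) : degeneracy (p i (w, t)) (x i j (w, t)) = 0.
  have rows_ge0 k : 0 <= \sum_(j' < m k) degeneracy (p k (w, t)) (x k j' (w, t)).
    by apply: sumr_ge0 => j' _; exact/degeneracy_ge0/l01.
  move: d0 => /psumr_eq0P/(_ i isT) di; apply: (psumr_eq0P _ (di _)) => // j' _.
  exact/degeneracy_ge0/l01.
rewrite expR_ge0/=; apply: expR_sum_tangent_le => //; first exact: risk01.
- by move=> j; exact: l01.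
- by move=> pE j; have [+ _] := degeneracy_eq0 (l01 _ _ _) (dij j); exact.
- by move=> pE j; have [_] := degeneracy_eq0 (l01 _ _ _) (dij j); exact.
Qed.

(** The event is defined through [bound], in which [u] and [v] do not occur; hence one event serves
    all of them. *)
Lemma good_event (delta : R) : 0 < delta ->
  exists E : set Omega, measurable E /\ (Pr E >= (1 - delta)%:E)%E /\
    forall w, E w -> forall u v : 'I_n -> R, (forall i, 0 < u i) -> (forall i, 0 < v i) ->
    (\int[P]_t (expR (\sum_i \sum_(j < m i)
       kl_tangent (u i) (v i) (l i (e i t) (z i j w)) (risk i (e i t))))%:E <=
     ((\prod_i (2 * Num.sqrt (m i)%:R)) / delta)%:E)%E.
Proof.
move=> delta0; rewrite -/W.
have W0 : 0 < W.
  by apply: prodr_gt0 => i _; rewrite mulr_gt0// sqrtr_gt0 ltr0n.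
pose I w := (\int[P]_t bound (w, t))%E.
have mI : measurable_fun setT I.
  exact: (@measurable_fun_fubini_tonelli_F _ _ _ _ _ P bound).
pose C : R := W / delta; have C0 : 0 < C by rewrite divr_gt0.
exists [set w | (I w <= C%:E)%E].
have mE : measurable [set w | (I w <= C%:E)%E].
  by rewrite -[X in measurable X]setTI; exact: emeasurable_fun_infty_c.
split => //; split; last first.
  move=> w /= Iw u v u0 v0; apply: (le_trans _ Iw); apply: le_integral_measurable => [||t].
  - apply/measurable_EFinP; apply: measurableT_comp; first exact: measurable_expR.
    apply: measurable_sum => i; apply: measurable_sum => j; apply: measurable_kl_tangent.
      exact: (measurableT_comp (mx i j) (pair1_measurable w)).
    exact: (measurableT_comp (measurable_risk i) (me i)).
  - exact: (measurableT_comp mbound (pair1_measurable w)).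
  - exact: (expR_le_bound w t u0 v0).
have I0 w : (0 <= I w)%E by apply: integral_ge0.
have EI : (\int[Pr]_w I w <= W%:E)%E.
  rewrite /I (fubini_tonelli (m1 := Pr) (m2 := P) bound mbound bound_ge0).
  apply: (@le_trans _ _ (\int[P]_t (cst W%:E t))%E).
    apply: ge0_le_integral => //.
    - by move=> t _; apply: integral_ge0.
    - exact: (@measurable_fun_fubini_tonelli_G _ _ _ _ _ Pr bound).
  by rewrite integral_cst// [X in (_ * X)%E](probability_setT P) mule1.
set E := [set w | _] in mE *.
(* Markov's inequality; with [C = W / delta] it gives the complement probability at most [delta]. *)
have : (C%:E * Pr (~` E) <= W%:E)%E.
  rewrite -integral_cst; last exact: measurableC.
  apply: le_trans EI; apply: (@le_trans _ _ (\int[Pr]_(w in ~` E) I w)%E).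
    apply: ge0_le_integral => //; first exact: measurableC.
    - by move=> w _; rewrite lee_fin ltW.
    - exact: measurable_funTS.
    - by move=> w /= /negP; rewrite -ltNge => /ltW.
  by apply: ge0_subset_integral => //; exact: measurableC.
have fE : Pr E \is a fin_num by exact: fin_num_measure.
rewrite probability_setC// -(fineK fE) -EFinB -EFinM !lee_fin /C.
rewrite mulrAC ler_pdivrMr// ler_pM2l//; lra.
Qed.

End good_event.

(** * Risks of posteriors *)

Section gibbs_risks.
Context dF dZ (F : measurableType dF) (Z : measurableType dZ) (R : realType).
Variables (n : nat) (D : 'I_n -> probability Z R) (l : 'I_n -> F -> Z -> R).
Hypothesis ml : forall i, measurable_fun setT (fun p : F * Z => l i p.1 p.2).
Hypothesis l01 : forall i f y, 0 <= l i f y <= 1.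

Lemma gibbs_loss01 i (Q : probability F R) y : 0 <= gibbs_loss (l i) Q y <= 1.
Proof. by apply: Rintegral_probability_itv => //; exact: measurable_loss_at. Qed.

(** Exchanging the expectations makes the risk a [Q]-mean of risks of single predictors, which can
    then be read as a mean under [frakQ]. *)
Lemma true_risk_fubini i (Q : probability F R) :
  true_risk (D i) (l i) Q = \int[Q]_f risk D l i f.
Proof.
congr fine; transitivity (\int[D i]_y \int[Q]_f (l i f y)%:E)%E.
  apply: eq_integral => y _; rewrite -EFin_Rintegral//.
  apply: (@bounded_integrable _ _ _ _ _ 1) => [|f]; first exact: measurable_loss_at.
  by have /andP[h0 h1] := l01 i f y; rewrite ger0_norm.
rewrite -(fubini_tonelli (m1 := Q) (m2 := D i)
  (fun q : F * Z => (l i q.1 q.2)%:E)) /=; last 2 first.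
- exact/measurable_EFinP.
- by move=> q; rewrite lee_fin; have /andP[] := l01 i q.1 q.2.
apply: eq_integral => f _; rewrite -EFin_Rintegral//.
apply: (@bounded_integrable _ _ _ _ _ 1) => [|y]; first exact: measurable_loss.
by have /andP[h0 h1] := l01 i f y; rewrite ger0_norm.
Qed.

Lemma true_risk01 i (Q : probability F R) : 0 <= true_risk (D i) (l i) Q <= 1.
Proof.
rewrite true_risk_fubini; apply: Rintegral_probability_itv; first exact: measurable_risk.
by move=> f; exact: risk01.
Qed.

Lemma emp_risk01 i m (s : nat -> Z) (Q : probability F R) : (0 < m)%N ->
  0 <= emp_risk m s (l i) Q <= 1.
Proof.
move=> m0; rewrite /emp_risk mulr_ge0 ?invr_ge0//=; last first.
  by apply: sumr_ge0 => j _; have /andP[] := gibbs_loss01 i Q (s j).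
rewrite ler_pdivrMl ?ltr0n// mulr1 -[leRHS]/(1 *+ m) -[m in leRHS]card_ord -sumr_const.
by apply: ler_sum => j _; have /andP[] := gibbs_loss01 i Q (s j).
Qed.

End gibbs_risks.

Lemma ln_prod (R : realType) (I : finType) (a : I -> R) : (forall i, 0 < a i) ->
  ln (\prod_i a i) = \sum_i ln (a i).
Proof.
move=> a0; suff [] : 0 < \prod_i a i /\ ln (\prod_i a i) = \sum_i ln (a i) by [].
elim/big_rec2 : _ => [|i x y _ [y0 xE]]; first by rewrite ln1.
by rewrite mulr_gt0// lnM ?posrE// xE.
Qed.

Lemma product_law_marginal d (F : measurableType d) (R : realType) (n : nat)
    (hQ : probability (pprobability F R) R) (Q : 'I_n -> probability F R)
    (frakQ : probability (pprobability F R * n.-tuple F)%type R) i (B : set F) :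
  is_product_law hQ Q frakQ -> measurable B ->
  frakQ ((fun t => tnth t.2 i) @^-1` B) = Q i B.
Proof.
move=> law mB; pose B' j := if j == i then B else setT.
have -> : (fun t : pprobability F R * n.-tuple F => tnth t.2 i) @^-1` B = setT `*` cyl B'.
  apply/seteqP; split => -[P f] /=; last by move=> [_ /(_ i)]; rewrite /B' eqxx.
  by move=> fB; split=> // j; rewrite /B'; case: eqP => // ->.
rewrite law//; last by move=> j; rewrite /B'; case: ifP.
rewrite (bigD1 i)//= {1}/B' eqxx big1 => [|j /negbTE ji]; last first.
  by rewrite /B' ji [X in fine X](probability_setT (Q j)).
by rewrite [X in fine X * _](probability_setT hQ) mul1r mulr1 fineK// fin_num_measure.
Qed.

Theorem theorem4 (R : realType)
  (dF : measure_display) (F : measurableType dF)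
  (dZ : measure_display) (Z : measurableType dZ)
  (n : nat) (m : 'I_n -> nat) (hm : forall i, (0 < m i)%N)
  (D : 'I_n -> probability Z R)
  (l : 'I_n -> F -> Z -> R)
  (hl_meas : forall i, measurable_fun setT (fun p : F * Z => l i p.1 p.2))
  (hl_range : forall i f z, 0 <= l i f z <= 1)
  (dO : measure_display) (Omega : measurableType dO) (Pr : probability Omega R)
  (z : 'I_n -> nat -> Omega -> Z) (hz : iid_samples Pr m D z)
  (hP : probability (pprobability F R) R)
  (frakP : probability (pprobability F R * n.-tuple F)%type R)
  (hfrakP : is_hyper_joint hP frakP)
  (delta : R) (hdelta : 0 < delta) :
  exists E : set Omega, measurable E /\ (Pr E >= (1 - delta)%:E)%E /\
    forall w, E w ->
    forall (hQ : probability (pprobability F R) R) (Q : 'I_n -> probability F R)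
           (frakQ : probability (pprobability F R * n.-tuple F)%type R),
      is_product_law hQ Q frakQ ->
      (\sum_(i < n) ((m i)%:R)%:E *
           kl (emp_risk (m i) (z i ^~ w) (l i) (Q i)) (true_risk (D i) (l i) (Q i))
       <= KL frakQ frakP + (ln (1 / delta))%:E
          + (\sum_(i < n) ln (2 * Num.sqrt ((m i)%:R)))%:E)%E.
Proof.
pose T := (pprobability F R * n.-tuple F)%type.
pose e i (t : T) := tnth t.2 i.
have me i : measurable_fun setT (e i).
  exact: (measurableT_comp (measurable_tnth i) measurable_snd).
have [E [mE [PE good]]] := good_event hm hl_meas hl_range hz frakP me hdelta.
exists E; do 2 split=> //; move=> w Ew hQ Q frakQ law.
pose q i := emp_risk (m i) (z i ^~ w) (l i) (Q i).
pose p i := true_risk (D i) (l i) (Q i).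
set rhs := (_ + _)%E.
pose W : R := \prod_i (2 * Num.sqrt (m i)%:R).
have sqrt2_gt0 i : 0 < 2 * Num.sqrt (m i)%:R :> R by rewrite mulr_gt0// sqrtr_gt0 ltr0n.
have W0 : 0 < W by apply: prodr_gt0.
have rhsE : (KL frakQ frakP + (ln (W / delta))%:E = rhs)%E.
  rewrite /rhs -addeA -EFinD; congr (_ + _%:E)%E.
  by rewrite ln_div ?posrE// ln_prod// div1r lnV ?posrE// addrC.
have marginal i (h : F -> R) : measurable_fun setT h -> (forall f, 0 <= h f) ->
    \int[frakQ]_t h (e i t) = \int[Q i]_f h f.
  by apply: Rintegral_law => // B mB; exact: (product_law_marginal i law mB).
(* By affinity the left side is the [frakQ]-mean of the function [phi] below, whose exponential
   moment under [frakP] is bounded on [E]. *)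
have main u v : (forall i, 0 < u i) -> (forall i, 0 < v i) ->
    ((\sum_i (m i)%:R * kl_tangent (u i) (v i) (q i) (p i))%:E <= rhs)%E.
  move=> u0 v0; have expB := good w Ew u v u0 v0.
  pose x i j t := l i (e i t) (z i j w); pose r i t := risk D l i (e i t).
  have mx i j : measurable_fun setT (x i j).
    exact: (measurableT_comp (measurable_loss_at hl_meas i (z i j w)) (me i)).
  have mr i : measurable_fun setT (r i).
    exact: (measurableT_comp (measurable_risk D hl_meas hl_range i) (me i)).
  have mk i j : measurable_fun setT (fun t => kl_tangent (u i) (v i) (x i j t) (r i t)).
    exact: measurable_kl_tangent.
  pose M := \sum_i \sum_(j < m i) (`|ln (u i)| + `|ln (v i)| + 1 + u i + v i).
  pose phi t := \sum_i \sum_(j < m i) kl_tangent (u i) (v i) (x i j t) (r i t).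
  have kb i j t : `|kl_tangent (u i) (v i) (x i j t) (r i t)| <=
      `|ln (u i)| + `|ln (v i)| + 1 + u i + v i.
    by apply: kl_tangent_bound => //; [exact: hl_range|exact: (risk01 D hl_meas hl_range)].
  have mphi : measurable_fun setT phi.
    by apply: measurable_sum => i; apply: measurable_sum => j.
  have phiM t : `|phi t| <= M.
    rewrite /phi (le_trans (ler_norm_sum _ _ _))//; apply: ler_sum => i _.
    by rewrite (le_trans (ler_norm_sum _ _ _))//; apply: ler_sum => j _.
  have := donsker_varadhan frakQ mphi phiM expB (divr_gt0 W0 hdelta).
  rewrite rhsE; suff -> : \int[frakQ]_t phi t =
    \sum_i (m i)%:R * kl_tangent (u i) (v i) (q i) (p i) by [].
  have ik i j : frakQ.-integrable setT
      (EFin \o (fun t => kl_tangent (u i) (v i) (x i j t) (r i t))).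
    exact: bounded_integrable (mk i j) (kb i j).
  rewrite /phi Rintegral_sum => [|i]; last by apply: integrable_sum_EFin => j; exact: ik.
  apply: eq_bigr => i _; rewrite -sum_kl_tangent// Rintegral_sum => [|j]; last exact: ik.
  apply: eq_bigr => j _; rewrite Rintegral_kl_tangent//; last 2 first.
  - by move=> t; exact: hl_range.
  - by move=> t; exact: (risk01 D hl_meas hl_range).
  have -> : \int[frakQ]_t x i j t = gibbs_loss (l i) (Q i) (z i j w).
    apply: (marginal i (l i ^~ (z i j w))) => [|f]; first exact: measurable_loss_at.
    by have /andP[] := hl_range i f (z i j w).
  suff -> : \int[frakQ]_t r i t = p i by [].
  rewrite /p true_risk_fubini//; apply: (marginal i (risk D l i)) => [|f].
    exact: measurable_risk.
  by have /andP[] := risk01 D hl_meas hl_range i f.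
(* Otherwise a real [M] separates the sides; distributing it over the tasks yields tangents whose
   weighted sum exceeds [M], against [main]. *)
rewrite leNgt; apply/negP => lt_rhs.
have [M rhsM ltM] : exists2 M : R, (rhs <= M%:E)%E &
    (M%:E < \sum_(i < n) ((m i)%:R)%:E * kl (q i) (p i))%E.
  (* Any one instance of [main] excludes [rhs = -oo]. *)
  have ler1 := main (fun=> 1) (fun=> 1) (fun=> ltr01) (fun=> ltr01).
  clearbody rhs; case: rhs ler1 lt_rhs {main rhsE} => [r _ lt_r|_|].
  - by exists r.
  - by rewrite ltNge leey.
  - by rewrite leeNy_eq.
have [b hb Mb] := lt_sume_split (fun i => kl_gtNy (q i) (p i) (m i)) ltM.
have /choice[uv huv] : forall i, exists uv : R * R, [/\ 0 < uv.1, 0 < uv.2 &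
    b i <= (m i)%:R * kl_tangent uv.1 uv.2 (q i) (p i)].
  move=> i; have [|||u [v [u0 v0 huv]]] := @lt_kl R (q i) (p i) (m i) (b i) (hm i).
  - exact: emp_risk01.
  - exact: true_risk01.
  - exact: hb.
  by exists (u, v).
have := main (fun i => (uv i).1) (fun i => (uv i).2).
have u0 i : 0 < (uv i).1 by have [] := huv i.
have v0 i : 0 < (uv i).2 by have [] := huv i.
move=> /(_ u0 v0) /le_trans/(_ rhsM); rewrite lee_fin leNgt => /negP; apply.
apply: (lt_le_trans Mb); apply: ler_sum => i _; by have [] := huv i.
Qed.
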